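(* Let $\mu$ be a positive regular Borel measure supported in a strip $\mathbb C_{\alpha_1,\alpha_2}=\{z\in\mathbb C:\alpha_2\ge\operatorname{Re}z\ge\alpha_1\}$ for some $\alpha_2\ge\alpha_1>0$, and let $1<p'\le q<\infty$, $q\ge2$. Then the following are equivalent: 1. The embedding $\mathcal L:L^p(0,\infty)\to L^q(\mathbb C_+,\mu)$, $f\mapsto\mathcal Lf$, is well-defined and bounded, with a bound only depending (for given $p,q$) on the constant $C$ in condition 2 and the ratio $\frac{\alpha_2}{\alpha_1}$. 2. There exists a constant $C>0$ such that $\mu(Q_I)\le C|I|^{q/p'}$ for all intervals $I\subset i\mathbb R$. 3. There exists a constant $C>0$ such that $\|\mathcal Le^{-\cdot z}\|_{L^q(\mathbb C_+,\mu)}\le C\|e^{-\cdot z}\|_{L^p(0,\infty)}$ for all $z\in\mathbb C_{\alpha_1,\alpha_2}$.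
   Context: $\mathbb C_+=\{\operatorname{Re}z>0\}$, $\mathcal Lf(s)=\int_0^\infty e^{-ts}f(t)\,dt$, and $p'$ is the conjugate exponent of $p$, $1/p+1/p'=1$, with $1<p<\infty$. $e^{-\cdot z}$ denotes the function $t\mapsto e^{-tz}$ on $(0,\infty)$. For a bounded interval $I\subset i\mathbb R$ of length $|I|$, $Q_I=\{x+iy:iy\in I,\ 0<x<|I|\}$. *)

(* Defs.v *)
Set Warnings "-notation-overridden,-notation-incompatible-prefix,-ambiguous-paths".
From HB Require Import structures.
From mathcomp Require Import all_boot all_order all_algebra.
From mathcomp Require Import all_classical all_reals all_analysis.
From mathcomp Require Import complex.

Set Implicit Arguments.
Unset Strict Implicit.
Unset Printing Implicit Defensive.

Import Order.TTheory GRing.Theory Num.Theory.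
Import numFieldNormedType.Exports.
Import Normc.

Local Open Scope classical_set_scope.
Local Open Scope ring_scope.
Local Open Scope complex_scope.

(* The complex plane with its Borel sigma-algebra. [R[i]^o] carries the topology
   of its norm, whose balls have radii in [R[i]]; a positive radius is a
   positive real, so this is the usual topology. *)
Definition borelC (R : realType) : measurableType (@open R[i]^o).-sigma :=
  g_sigma_algebraType (@open R[i]^o).

Definition expC (R : realType) (z : R[i]) : R[i] :=
  (expR (complex.Re z))%:C * (cos (complex.Im z) +i* sin (complex.Im z)).

Definition posreals (R : realType) : set R := `]0, +oo[.

Definition Cplus (R : realType) : set R[i] := [set z | 0 < complex.Re z].

Arguments posreals R : clear implicits.
Arguments Cplus R : clear implicits.

Definition strip (R : realType) (a1 a2 : R) : set R[i] :=
  [set z | a1 <= complex.Re z <= a2].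

Section complex_valued.
Context d (T : measurableType d) (R : realType).
Variables (mu : {measure set T -> \bar R}) (D : set T).

Definition measurableC (g : T -> R[i]) : Prop :=
  measurable_fun D (fun x => complex.Re (g x)) /\
  measurable_fun D (fun x => complex.Im (g x)).

Definition integrableC (g : T -> R[i]) : Prop :=
  mu.-integrable D (fun x => (complex.Re (g x))%:E) /\
  mu.-integrable D (fun x => (complex.Im (g x))%:E).

Definition integralC (g : T -> R[i]) : R[i] :=
  Rintegral mu D (fun x => complex.Re (g x)) +i*
  Rintegral mu D (fun x => complex.Im (g x)).

Definition LnormC (p : R) (g : T -> R[i]) : \bar R :=
  'N[mu]_(p%:E)[(fun x => (normc (g x))%:E) \_ D].

Definition memLC (p : R) (g : T -> R[i]) : Prop :=
  measurableC g /\ (LnormC p g < +oo)%E.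

End complex_valued.

Definition laplace_integrand (R : realType) (f : R -> R[i]) (s : R[i]) :
    R -> R[i] := fun t => expC (- (t%:C * s)) * f t.

Definition laplace (R : realType) (f : R -> R[i]) (s : R[i]) : R[i] :=
  integralC (@lebesgue_measure R) (posreals R) (laplace_integrand f s).

Definition exp_fun (R : realType) (z : R[i]) : R -> R[i] :=
  fun t => expC (- (t%:C * z)).

(* Regularity as in Rudin: every Borel set is outer regular and inner regular.
   Finiteness on compact sets is not included. *)
Definition regular_measure (R : realType)
    (mu : {measure set (borelC R) -> \bar R}) : Prop :=
  forall A : set (borelC R), measurable A ->
    mu A = ereal_inf [set mu U | U in [set U : set R[i]^o | open U /\ A `<=` U]] /\
    mu A = ereal_sup [set mu K | K in [set K : set R[i]^o | compact K /\ K `<=` A]].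

Definition supported_in (R : realType)
    (mu : {measure set (borelC R) -> \bar R}) (S : set R[i]) : Prop :=
  mu (~` S) = 0%E.

(* An interval of the imaginary axis is given by its set I of imaginary
   parts. *)
Definition interval_length (R : realType) (I : set R) : R :=
  fine (lebesgue_measure I).

Definition carleson_square (R : realType) (I : set R) : set R[i] :=
  [set z | I (complex.Im z) /\ 0 < complex.Re z < interval_length I].

(* "The Laplace transform L^p(0,oo) -> L^q(C_+, mu) is well defined and bounded
   with bound M". *)
Definition laplace_bounded_by (R : realType)
    (mu : {measure set (borelC R) -> \bar R}) (p q M : R) : Prop :=
  forall f : R -> R[i], memLC (@lebesgue_measure R) (posreals R) p f ->
    [/\ forall s, Cplus R s ->
          integrableC (@lebesgue_measure R) (posreals R) (laplace_integrand f s),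
        memLC mu (Cplus R) q (laplace f) &
        (LnormC mu (Cplus R) q (laplace f) <=
         M%:E * LnormC (@lebesgue_measure R) (posreals R) p f)%E].

Definition carleson_condition (R : realType)
    (mu : {measure set (borelC R) -> \bar R}) (r C : R) : Prop :=
  forall I : set R, is_interval I -> bounded_set I ->
    (mu (carleson_square I) <= (C * interval_length I `^ r)%:E)%E.

Definition laplace_exp_condition (R : realType)
    (mu : {measure set (borelC R) -> \bar R}) (p q a1 a2 C : R) : Prop :=
  forall z : R[i], strip a1 a2 z ->
    (LnormC mu (Cplus R) q (laplace (exp_fun z)) <=
     C%:E * LnormC (@lebesgue_measure R) (posreals R) p (exp_fun z))%E.

(* Main.v *)
Require Import Defs.
From mathcomp Require Import all_boot all_order all_algebra.
From mathcomp Require Import all_classical all_reals all_analysis.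
From mathcomp Require Import measurable_realfun.
From mathcomp Require Import complex.
From mathcomp Require Import ring lra.

Set Implicit Arguments.
Unset Strict Implicit.
Unset Printing Implicit Defensive.

Import Order.TTheory GRing.Theory Num.Theory.
Import numFieldNormedType.Exports.
Import Normc.

Local Open Scope classical_set_scope.
Local Open Scope ring_scope.

(** Write [r = q / p']; it is at least 1.

    From the embedding to the estimate on exponentials: [t |-> e^(-tz)] is a
    member of [L^p] when [Re z > 0], so it may be inserted
    ([laplace_bounded_to_exp]).

    From exponentials to the Carleson condition: the transform of [e^(-tz)] at
    [s] is [1 / (s + z)].  With [z = a1 - ic], its real part is bounded below
    on the part of the strip with [c <= Im s <= c + 2 a2], so the estimate
    bounds the mass of each such box by a constant ([exp_box_measure]).  A
    square [Q_I] with [|I| <= a1] does not meet the strip; a larger one is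
    covered, within the strip, by at most [2 |I| / a1] boxes, which is at most
    a multiple of [|I|^r] because [r >= 1] ([exp_to_carleson]).

    From the Carleson condition to the embedding: the heart is the estimate
      [int_strip |L f|^2 dmu <= 8 S int |f(t)|^2 e^(- a1 t) dt],
    with [S] a multiple of [C a2^(r+1) / a1^2] ([laplace_l2]).  Real and
    imaginary parts of [L f] are sums of damped cosine and sine transforms of
    real functions.  The composition of such a transform with its adjoint is an
    integral operator on [L^2(mu)] with kernel
      [1/2 (P_s (y - v) + e P_s (y + v))], [P_s (y) = s / (s^2 + y^2)],
    where [x + iy] and [u + iv] are the two points, [s = x + u - a1], and
    [e = 1] for the cosine and [e = -1] for the sine.  As [P_s] is positive and
    decays quadratically in [y], while [mu] gives bounded mass to the bands of
    height [2 a2] of the strip, its integrals are bounded ([strip_decay_integral])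
    and Schur's test applies ([schur_test]).  This takes the place of
    Plancherel's theorem.

    To reach the exponent [p], note that [|L f| <= A = 4 ||f||_p a1^(-1/p')] on
    the strip ([laplace_sup]), so that it suffices to bound a power of [|L f|]
    with an exponent at most [q] ([laplace_raise_exponent]).  If [p >= 2], the
    exponent 2 will do, since the damping factor embeds [L^p] into the weighted
    [L^2].  If [p < 2], the exponent [p'] is obtained from the pair
    [L^1 -> L^oo], [L^2 -> L^2(mu)] by Marcinkiewicz interpolation
    ([laplace_marcinkiewicz]); this plays the part of the Hausdorff-Young
    inequality.  In both cases the powers of [a1] cancel except in the ratio
    [a2 / a1] ([scaling_exponents]). *)

(** * Parametric integrals and a dominated Fubini theorem *)

Section parametric.
Context d1 d2 (T1 : measurableType d1) (T2 : measurableType d2) (R : realType).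
Variables (m : {sigma_finite_measure set T1 -> \bar R}).
Variables (l : {sigma_finite_measure set T2 -> \bar R}).

(** The positive and negative parts are handled by Tonelli, and their
    difference followed by [fine] is measurable whatever its values. *)
Lemma measurable_Rintegral_r (F : T1 * T2 -> R) : measurable_fun setT F ->
  measurable_fun setT (fun z => \int[l]_t F (z, t)).
Proof.
move=> mF; pose EF x := (F x)%:E.
have mEF : measurable_fun setT EF by exact/measurable_EFinP.
have FE : (fun z => \int[l]_t EF (z, t))%E =
    ((fun z => \int[l]_t EF^\+ (z, t)) \- (fun z => \int[l]_t EF^\- (z, t)))%E.
  apply/funext => z; rewrite [LHS]integralE.
  under eq_integral do rewrite funepos_comp/=.
  by under [X in (_ - X)%E = _]eq_integral do rewrite funeneg_comp/=.
have -> : (fun z => \int[l]_t F (z, t)) = fine \o (fun z => \int[l]_t EF (z, t))%E.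
  by [].
rewrite FE.
apply: measurableT_comp => //; apply: emeasurable_funB.
  by apply: measurable_fun_fubini_tonelli_F => //; exact: measurable_funepos.
by apply: measurable_fun_fubini_tonelli_F => //; exact: measurable_funeneg.
Qed.

Lemma measurable_Rintegral_l (F : T1 * T2 -> R) : measurable_fun setT F ->
  measurable_fun setT (fun t => \int[m]_z F (z, t)).
Proof.
move=> mF; pose EF x := (F x)%:E.
have mEF : measurable_fun setT EF by exact/measurable_EFinP.
have FE : (fun t => \int[m]_z EF (z, t))%E =
    ((fun t => \int[m]_z EF^\+ (z, t)) \- (fun t => \int[m]_z EF^\- (z, t)))%E.
  apply/funext => t; rewrite [LHS]integralE.
  under eq_integral do rewrite funepos_comp/=.
  by under [X in (_ - X)%E = _]eq_integral do rewrite funeneg_comp/=.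
have -> : (fun t => \int[m]_z F (z, t)) = fine \o (fun t => \int[m]_z EF (z, t))%E.
  by [].
rewrite FE.
apply: measurableT_comp => //; apply: emeasurable_funB.
  by apply: measurable_fun_fubini_tonelli_G => //; exact: measurable_funepos.
by apply: measurable_fun_fubini_tonelli_G => //; exact: measurable_funeneg.
Qed.

End parametric.

Lemma Rintegrable_le d (T : measurableType d) (R : realType)
    (m : {measure set T -> \bar R}) (D : set T) (f g : T -> R) :
  measurable D -> measurable_fun D f ->
  (forall x, D x -> `|f x| <= g x) ->
  m.-integrable D (EFin \o g) -> m.-integrable D (EFin \o f).
Proof.
move=> mD mf fg ig; apply: le_integrable ig => //; first exact/measurable_EFinP.
move=> x Dx /=; rewrite lee_fin (le_trans (fg x Dx))//; exact: ler_norm.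
Qed.

Section real_integrable.
Context d (T : measurableType d) (R : realType).
Variables (m : {measure set T -> \bar R}) (D : set T).
Hypothesis mD : measurable D.
Implicit Types f g : T -> R.

Lemma RintegrableD f g : m.-integrable D (fun x => (f x)%:E) ->
  m.-integrable D (fun x => (g x)%:E) ->
  m.-integrable D (fun x => (f x + g x)%:E).
Proof. by move=> If Ig; have := integrableD mD If Ig. Qed.

Lemma RintegrableZl (c : R) f : m.-integrable D (fun x => (f x)%:E) ->
  m.-integrable D (fun x => (c * f x)%:E).
Proof. by move=> If; have := integrableZl mD c If. Qed.

End real_integrable.

Section dominated_fubini.
Context d1 d2 (T1 : measurableType d1) (T2 : measurableType d2) (R : realType).
Variables (m : {finite_measure set T1 -> \bar R}).
Variables (l : {sigma_finite_measure set T2 -> \bar R}).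
Variables (F : T1 * T2 -> R) (w : T2 -> R).
Hypothesis mF : measurable_fun setT F.
Hypothesis Fw : forall z t, `|F (z, t)| <= w t.

Lemma integrable_constant (c : R) : m.-integrable setT (EFin \o cst c).
Proof. exact: finite_measure_integrable_cst. Qed.

Lemma dominated_integrable_l t : m.-integrable setT (fun z => (F (z, t))%:E).
Proof.
apply: (@Rintegrable_le _ _ _ _ _ _ (cst (w t))) => //.
- by apply: measurableT_comp => //; exact: measurable_pair2.
- exact: integrable_constant.
Qed.

Lemma dominated_bound_l t : `|\int[m]_z F (z, t)| <= w t * fine (m setT).
Proof.
apply: le_trans (le_normr_Rintegral _ (dominated_integrable_l t)) _ => //.
rewrite -Rintegral_cst//; apply: le_Rintegral => //.
- exact: (integrable_norm (dominated_integrable_l t)).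
- exact: integrable_constant.
Qed.

Hypothesis iw : l.-integrable setT (EFin \o w).

Lemma dominated_integrable_r z : l.-integrable setT (fun t => (F (z, t))%:E).
Proof.
apply: (@Rintegrable_le _ _ _ _ _ _ w) => //.
by apply: measurableT_comp => //; exact: measurable_pair1.
Qed.

Lemma dominated_bound_r z : `|\int[l]_t F (z, t)| <= \int[l]_t w t.
Proof.
apply: le_trans (le_normr_Rintegral _ (dominated_integrable_r z)) _ => //.
apply: le_Rintegral => //; exact: (integrable_norm (dominated_integrable_r z)).
Qed.

(** A bound by an integrable function of the second variable alone, together
    with the finiteness of [m], makes every partial integral finite; Fubini then
    holds for real-valued integrals without exceptional null sets. *)
Lemma dominated_Fubini :
  \int[m]_z \int[l]_t F (z, t) = \int[l]_t \int[m]_z F (z, t).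
Proof.
congr fine.
under eq_integral do rewrite fineK ?(integrable_fin_num _ (dominated_integrable_r _))//.
under [RHS]eq_integral do
  rewrite fineK ?(integrable_fin_num _ (dominated_integrable_l _))//.
apply: (@Fubini _ _ _ _ _ m l (fun x => (F x)%:E)).
apply/integrable12ltyP; first exact/measurable_EFinP.
apply: (@le_lt_trans _ _ (\int[m]_z (\int[l]_t (w t)%:E))%E); last first.
  rewrite integral_cst// -ge0_fin_numE.
    by rewrite fin_numM//; [exact: integrable_fin_num|exact: fin_num_measure].
  apply: mule_ge0 => //; apply: integral_ge0 => t _; rewrite lee_fin.
  exact: le_trans (normr_ge0 _) (Fw point t).
apply: ge0_le_integral => //.
- by move=> z _; exact: integral_ge0.
- apply: (@measurable_fun_fubini_tonelli_F _ _ _ _ _ l (fun x => `|(F x)%:E|)%E) => //.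
  by apply: measurableT_comp => //; exact/measurable_EFinP.
- move=> z _; apply: ge0_le_integral => //.
  + apply/measurable_EFinP; apply: measurableT_comp => //.
    by apply: measurableT_comp => //; exact: measurable_pair1.
  + by case/integrableP : iw.
  + by move=> t _; rewrite lee_fin.
Qed.

End dominated_fubini.

(** * Schur's test applied to an operator composed with its adjoint *)

(** The arithmetic-geometric mean inequality with weight [|c|]. *)
Lemma weighted_prod_le_sqr (R : realFieldType) (a b c : R) :
  a * (b * c) <= 2^-1 * (`|c| * a ^+ 2) + 2^-1 * (`|c| * b ^+ 2).
Proof.
have [c0|c0] := leP 0 c.
  by rewrite ger0_norm//; have := mulr_ge0 c0 (sqr_ge0 (a - b)); lra.
by rewrite ltr0_norm//; have := mulr_le0_ge0 (ltW c0) (sqr_ge0 (a + b)); lra.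
Qed.

Section symmetric_schur.
Context d (T : measurableType d) (R : realType).
Variables (m : {finite_measure set T -> \bar R}).
Variables (kappa : T * T -> R) (H : T -> R) (S M B : R).
Hypothesis mkappa : measurable_fun setT kappa.
Hypothesis mH : measurable_fun setT H.
Hypothesis M0 : 0 <= M.
Hypothesis B0 : 0 <= B.
Hypothesis kappaM : forall zw, `|kappa zw| <= M.
Hypothesis HB : forall z, `|H z| <= B.
Hypothesis kappaC : forall z w, kappa (z, w) = kappa (w, z).
Hypothesis kappaS : forall z, \int[m]_w `|kappa (z, w)| <= S.

(** [|H z H w| <= (H z ^2 + H w ^2) / 2] reduces the bilinear form to
    [int H^2 int |kappa|]; the two halves agree by symmetry. *)
Lemma schur_form : \int[m]_z (H z * \int[m]_w (H w * kappa (z, w))) <=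
  S * \int[m]_z (H z ^+ 2).
Proof.
pose Q (x : T * T) := `|kappa x| * H x.1 ^+ 2.
pose Q' (x : T * T) := `|kappa x| * H x.2 ^+ 2.
have mH1 : measurable_fun setT (fun x : T * T => H x.1).
  exact: (measurableT_comp mH).
have mH2 : measurable_fun setT (fun x : T * T => H x.2).
  exact: (measurableT_comp mH).
have mkz z : measurable_fun setT (fun w => kappa (z, w)).
  by apply: (measurableT_comp mkappa); exact: measurable_pair1.
have mQ : measurable_fun setT Q.
  by apply: measurable_funM; [exact: measurableT_comp|exact: measurable_funX].
have mQ' : measurable_fun setT Q'.
  by apply: measurable_funM; [exact: measurableT_comp|exact: measurable_funX].
have H2_le z : `|H z ^+ 2| <= B ^+ 2.
  by rewrite normrX ler_pXn2r ?nnegrE.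
have Q_le z w : `|Q (z, w)| <= cst (M * B ^+ 2) w.
  by rewrite /Q/= normrM normr_id ler_pM.
have Q'_le z w : `|Q' (z, w)| <= cst (M * B ^+ 2) w.
  by rewrite /Q'/= normrM normr_id ler_pM.
have ic := integrable_constant m.
have iQ z := dominated_integrable_r mQ Q_le (ic _) z.
have iQ' z := dominated_integrable_r mQ' Q'_le (ic _) z.
have QS z : \int[m]_w Q (z, w) <= S * H z ^+ 2.
  rewrite /Q/= RintegralZr//; first by rewrite ler_wpM2r ?sqr_ge0.
  apply: (@Rintegrable_le _ _ _ _ _ _ (cst M)) => //.
    exact: measurableT_comp.
  by move=> w _; rewrite normr_id.
have bQ z := dominated_bound_r mQ Q_le (ic _) z.
have bQ' z := dominated_bound_r mQ' Q'_le (ic _) z.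
have iQQ : m.-integrable setT (EFin \o (fun z => \int[m]_w Q (z, w))).
  apply: (Rintegrable_le _ _ _ (ic _)); [by [] | | by move=> z _; exact: bQ].
  exact: (measurable_Rintegral_r m mQ).
have iQQ' : m.-integrable setT (EFin \o (fun z => \int[m]_w Q' (z, w))).
  apply: (Rintegrable_le _ _ _ (ic _)); [by [] | | by move=> z _; exact: bQ'].
  exact: (measurable_Rintegral_r m mQ').
have iH2 : m.-integrable setT (EFin \o (fun z => H z ^+ 2)).
  apply: (@Rintegrable_le _ _ _ _ _ _ (cst (B ^+ 2))) => //.
  exact: measurable_funX.
have iSH : m.-integrable setT (EFin \o (fun z => S * H z ^+ 2)).
  exact: RintegrableZl.
have intQ : \int[m]_z \int[m]_w Q (z, w) <= S * \int[m]_z (H z ^+ 2).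
  by rewrite -RintegralZl//; exact: le_Rintegral.
have intQ' : \int[m]_z \int[m]_w Q' (z, w) = \int[m]_z \int[m]_w Q (z, w).
  rewrite (dominated_Fubini m mQ' Q'_le (ic _)).
  by apply: eq_Rintegral => z _; apply: eq_Rintegral => w _;
    rewrite /Q/Q'/= kappaC.
have mHkap : measurable_fun setT (fun x : T * T => H x.1 * (H x.2 * kappa x)).
  by apply: measurable_funM => //; exact: measurable_funM.
have Hkap_le z w : `|H z * (H w * kappa (z, w))| <= cst (B * (B * M)) w.
  by rewrite /= 2!normrM ler_pM ?mulr_ge0// ler_pM.
have iHk z := dominated_integrable_r mHkap Hkap_le (ic _) z.
have iHHk : m.-integrable setT
    (EFin \o (fun z => \int[m]_w (H z * (H w * kappa (z, w))))).
  apply: (Rintegrable_le _ _ _ (ic _)); first by [].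
    exact: (measurable_Rintegral_r m mHkap).
  by move=> z _; exact: (dominated_bound_r mHkap Hkap_le (ic _) z).
have mHkz z : measurable_fun setT (fun w => H w * kappa (z, w)).
  exact: measurable_funM.
have -> : \int[m]_z (H z * \int[m]_w (H w * kappa (z, w))) =
    \int[m]_z \int[m]_w (H z * (H w * kappa (z, w))).
  apply: eq_Rintegral => z _; rewrite RintegralZl//.
  apply: (@Rintegrable_le _ _ _ _ _ _ (cst (B * M))) => //.
    by move=> w _; rewrite normrM ler_pM.
apply: (@le_trans _ _
    (\int[m]_z (2^-1 * \int[m]_w Q (z, w) + 2^-1 * \int[m]_w Q' (z, w)))); last first.
  rewrite RintegralD//; [|exact: RintegrableZl|exact: RintegrableZl].
  rewrite !RintegralZl// intQ'.
  rewrite -mulrDl (_ : 2^-1 + 2^-1 = 1) ?mul1r//.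
  by field.
have iZQ z := RintegrableZl measurableT 2^-1 (iQ z).
have iZQ' z := RintegrableZl measurableT 2^-1 (iQ' z).
apply: le_Rintegral; [by []|exact: iHHk| |move=> z _].
  by apply: RintegrableD; [by []| |]; exact: RintegrableZl.
rewrite -(RintegralZl _ measurableT (iQ z)) -(RintegralZl _ measurableT (iQ' z)).
rewrite -(RintegralD measurableT (iZQ z) (iZQ' z)).
apply: le_Rintegral; [by []|exact: iHk| |].
  exact: (RintegrableD measurableT (iZQ z) (iZQ' z)).
move=> w _; rewrite /Q /Q'/=.
exact: weighted_prod_le_sqr.
Qed.

End symmetric_schur.

Section schur.
Context d1 d2 (T1 : measurableType d1) (T2 : measurableType d2) (R : realType).
Variables (m : {finite_measure set T1 -> \bar R}).
Variables (l : {sigma_finite_measure set T2 -> \bar R}).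
Variables (k : T1 * T2 -> R) (h : T2 -> R) (S : R).
Hypothesis mk : measurable_fun setT k.
Hypothesis kh : forall z t, `|k (z, t)| <= h t.
Hypothesis h1 : forall t, h t <= 1.
Hypothesis ih : l.-integrable setT (EFin \o h).
Hypothesis S0 : 0 < S.

Let kappa z w := \int[l]_t (k (z, t) * k (w, t)).

Hypothesis kappaS : forall z, \int[m]_w `|kappa z w| <= S.

Let h0 t : 0 <= h t. Proof. exact: le_trans (normr_ge0 _) (kh point t). Qed.

Let mh : measurable_fun setT h.
Proof. by case/integrableP : ih => /measurable_EFinP. Qed.

Let mkz z : measurable_fun setT (fun t => k (z, t)).
Proof. by apply: measurableT_comp => //; exact: measurable_pair1. Qed.

Let kk_le z w t : `|k (z, t) * k (w, t)| <= h t.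
Proof.
by rewrite normrM -[leRHS]mulr1 ler_pM// (le_trans (kh _ _)).
Qed.

Let kappaC z w : kappa z w = kappa w z.
Proof. by apply: eq_Rintegral => t _; rewrite mulrC. Qed.

Let mkappa : measurable_fun setT (fun zw : T1 * T1 => kappa zw.1 zw.2).
Proof.
apply: (measurable_Rintegral_r l
  (F := fun x : (T1 * T1) * T2 => k (x.1.1, x.2) * k (x.1.2, x.2))).
apply: measurable_funM; apply: measurableT_comp => //;
  apply: measurable_fun_pair => //; exact: measurableT_comp.
Qed.

Let mkappaz z : measurable_fun setT (kappa z).
Proof.
apply: (measurable_Rintegral_r l (F := fun x : T1 * T2 => k (z, x.2) * k x)).
apply: measurable_funM => //; exact: (measurableT_comp (mkz z)).
Qed.

Let kappa_bound z w : `|kappa z w| <= \int[l]_t h t.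
Proof.
have mkk : measurable_fun setT (fun x : T1 * T2 => k (z, x.2) * k (w, x.2)).
  by apply: measurable_funM; apply: measurableT_comp => //;
    apply: measurable_fun_pair => //.
exact: (dominated_bound_r mkk (fun _ t => kk_le z w t) ih point).
Qed.

Section fixed_function.
Variables (g : T2 -> R).
Hypothesis mg : measurable_fun setT g.
Hypothesis ig : l.-integrable setT (fun t => (g t ^+ 2)%:E).

Let H z := \int[l]_t (k (z, t) * g t).
Let G t := \int[m]_z (H z * k (z, t)).

Let ihg : l.-integrable setT (EFin \o (fun t => h t * `|g t|)).
Proof.
apply: (@Rintegrable_le _ _ _ _ _ _ (fun t => h t + g t ^+ 2)) => //.
- by apply: measurable_funM => //; exact: measurableT_comp.
- move=> t _; rewrite ger0_norm ?mulr_ge0//.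
  rewrite -(real_normK (num_real (g t))).
  have : 0 <= h t * (1 - h t) by rewrite mulr_ge0 ?subr_ge0.
  by move: (sqr_ge0 (`|g t| - h t / 2)); nra.
- exact: RintegrableD.
Qed.

Let kg_le z t : `|k (z, t) * g t| <= h t * `|g t|.
Proof. by rewrite normrM ler_wpM2r. Qed.

Let mkg : measurable_fun setT (fun x : T1 * T2 => k x * g x.2).
Proof. by apply: measurable_funM => //; exact: measurableT_comp. Qed.

Let mH : measurable_fun setT H.
Proof. exact: (measurable_Rintegral_r l mkg). Qed.

Let MH := \int[l]_t (h t * `|g t|).

Let H_le z : `|H z| <= MH.
Proof. exact: (dominated_bound_r mkg (fun z t => kg_le z t) ihg z). Qed.

Let MH0 : 0 <= MH. Proof. by apply: Rintegral_ge0 => t _; rewrite mulr_ge0. Qed.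

Let mHk : measurable_fun setT (fun x : T1 * T2 => H x.1 * k x).
Proof. by apply: measurable_funM => //; exact: measurableT_comp. Qed.

Let Hk_le z t : `|H z * k (z, t)| <= MH * h t.
Proof. by rewrite normrM ler_pM. Qed.

Let mG : measurable_fun setT G.
Proof. exact: (measurable_Rintegral_l m mHk). Qed.

Let MG := MH * fine (m setT).

Let MG0 : 0 <= MG. Proof. by rewrite mulr_ge0// fine_ge0. Qed.

Let G_le t : `|G t| <= MG * h t.
Proof.
have := dominated_bound_l m (w := fun t => MH * h t) mHk Hk_le t.
by rewrite /MG mulrAC.
Qed.

Let iZh (c : R) : l.-integrable setT (EFin \o (fun t => c * h t)).
Proof.
exact: RintegrableZl.
Qed.

Let iH2 : m.-integrable setT (fun z => (H z ^+ 2)%:E).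
Proof.
apply: (@Rintegrable_le _ _ _ _ _ _ (cst (MH ^+ 2))) => //.
- exact: measurable_funX.
- by move=> z _; rewrite normrX ler_pXn2r ?nnegrE.
- exact: integrable_constant.
Qed.

Let iG2 : l.-integrable setT (fun t => (G t ^+ 2)%:E).
Proof.
apply: (@Rintegrable_le _ _ _ _ _ _ (fun t => MG ^+ 2 * h t)) => //.
- exact: measurable_funX.
- move=> t _; rewrite normrX (@le_trans _ _ ((MG * h t) ^+ 2))//.
    rewrite ler_pXn2r ?nnegrE ?normr_ge0 ?(mulr_ge0 MG0 (h0 t))//.
  rewrite exprMn ler_wpM2l ?sqr_ge0// expr2.
  by rewrite -[leRHS]mulr1 ler_wpM2l.
Qed.

Let norm_H : \int[m]_z (H z ^+ 2) = \int[l]_t (g t * G t).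
Proof.
pose F (x : T1 * T2) := H x.1 * (k x * g x.2).
have mF : measurable_fun setT F.
  by apply: measurable_funM => //; exact: measurableT_comp.
have F_le z t : `|F (z, t)| <= MH * (h t * `|g t|).
  by rewrite /F/= normrM ler_pM.
have iF : l.-integrable setT (EFin \o (fun t => MH * (h t * `|g t|))).
  exact: RintegrableZl.
transitivity (\int[m]_z \int[l]_t F (z, t)).
  apply: eq_Rintegral => z _; rewrite /F/= RintegralZl//.
  exact: (dominated_integrable_r mkg (fun z t => kg_le z t) ihg z).
rewrite (dominated_Fubini m mF F_le iF).
apply: eq_Rintegral => t _; rewrite /F/= -RintegralZl//; last first.
  exact: (dominated_integrable_l m (w := fun t => MH * h t) mHk Hk_le t).
by apply: eq_Rintegral => z _; rewrite [RHS]mulrC mulrA.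
Qed.

Let J z : \int[l]_t (G t * k (z, t)) = \int[m]_w (H w * kappa z w).
Proof.
pose F (x : T1 * T2) := H x.1 * (k (z, x.2) * k x).
have mF : measurable_fun setT F.
  apply: measurable_funM; first exact: measurableT_comp.
  apply: measurable_funM => //; exact: (measurableT_comp (mkz z)).
have F_le w t : `|F (w, t)| <= MH * h t.
  by rewrite /F/= normrM ler_pM.
transitivity (\int[l]_t \int[m]_w F (w, t)).
  apply: eq_Rintegral => t _; rewrite -RintegralZr//; last first.
    exact: (dominated_integrable_l m (w := fun t => MH * h t) mHk Hk_le t).
  by apply: eq_Rintegral => w _; rewrite /F/= -mulrA [k (w, t) * _]mulrC.
rewrite -(dominated_Fubini m mF F_le (iZh MH)).
apply: eq_Rintegral => w _; rewrite /F/= RintegralZl//.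
have mkk : measurable_fun setT (fun x : T1 * T2 => k (z, x.2) * k (w, x.2)).
  by apply: measurable_funM; apply: measurableT_comp => //;
    apply: measurable_fun_pair => //.
exact: (dominated_integrable_r mkk (fun _ t => kk_le z w t) ih point).
Qed.

Let norm_G : \int[l]_t (G t ^+ 2) = \int[m]_z (H z * \int[m]_w (H w * kappa z w)).
Proof.
pose F (x : T1 * T2) := G x.2 * (H x.1 * k x).
have mF : measurable_fun setT F.
  by apply: measurable_funM => //; exact: measurableT_comp.
have F_le z t : `|F (z, t)| <= MG * MH * h t.
  rewrite /F/= normrM (le_trans (ler_pM _ _ (G_le t) (Hk_le z t)))//.
  have hh : h t * h t <= h t by apply: ler_piMr.
  by rewrite mulrACA; exact: (ler_wpM2l (mulr_ge0 MG0 MH0) hh).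
have mGk : measurable_fun setT (fun x : T1 * T2 => G x.2 * k x).
  by apply: measurable_funM => //; exact: measurableT_comp.
have Gk_le z t : `|G t * k (z, t)| <= MG * h t.
  by rewrite normrM -[leRHS]mulr1 ler_pM// (le_trans (kh _ _)).
transitivity (\int[l]_t \int[m]_z F (z, t)).
  apply: eq_Rintegral => t _; rewrite /F/= RintegralZl//.
  exact: (dominated_integrable_l m (w := fun t => MH * h t) mHk Hk_le t).
rewrite -(dominated_Fubini m mF F_le (iZh _)).
apply: eq_Rintegral => z _; rewrite -J /F/= -RintegralZl//; last first.
  exact: (dominated_integrable_r mGk Gk_le (iZh MG) z).
by apply: eq_Rintegral => t _; rewrite mulrCA.
Qed.

Let norm_G_le : \int[l]_t (G t ^+ 2) <= S * \int[m]_z (H z ^+ 2).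
Proof.
rewrite norm_G.
apply: (@schur_form _ _ _ m (fun zw => kappa zw.1 zw.2) H S (\int[l]_t h t) MH).
- exact: mkappa.
- exact: mH.
- exact: MH0.
- by move=> zw; exact: kappa_bound.
- exact: H_le.
- by move=> z w; exact: kappaC.
- exact: kappaS.
Qed.

Let schur_test_fin : \int[m]_z (H z ^+ 2) <= S * \int[l]_t (g t ^+ 2).
Proof.
have GH := norm_G_le.
suff : 2 * \int[m]_z (H z ^+ 2) <=
    S * \int[l]_t (g t ^+ 2) + S^-1 * \int[l]_t (G t ^+ 2).
  have : S^-1 * \int[l]_t (G t ^+ 2) <= \int[m]_z (H z ^+ 2).
    by rewrite mulrC ler_pdivrMr// mulrC.
  lra.
have igG : l.-integrable setT (EFin \o (fun t => g t * G t)).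
  apply: (@Rintegrable_le _ _ _ _ _ _ (fun t => g t ^+ 2 + G t ^+ 2)) => //.
  - exact: measurable_funM.
  - move=> t _; rewrite normrM -(real_normK (num_real (g t))).
    rewrite -(real_normK (num_real (G t))).
    by move: (sqr_ge0 (`|g t| - `|G t|)) (sqr_ge0 (`|g t| + `|G t|)); nra.
  - exact: RintegrableD.
rewrite norm_H -!RintegralZl// -RintegralD//; last 2 first.
- exact: RintegrableZl.
- exact: RintegrableZl.
apply: le_Rintegral => //.
- exact: RintegrableZl.
- by apply: RintegrableD => //; exact: RintegrableZl.
move=> t _; rewrite -subr_ge0.
have -> : S * g t ^+ 2 + S^-1 * G t ^+ 2 - 2 * (g t * G t) =
    S^-1 * (S * g t - G t) ^+ 2 by field; rewrite gt_eqF.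
by rewrite mulr_ge0 ?sqr_ge0// invr_ge0 ltW.
Qed.

(** With [H] the transform of [g] and [G] the adjoint transform of [H], Fubini
    gives [int H^2 = int g G] and [int G^2 = int int H H kappa <= S int H^2].
    Then [2 int H^2 <= S int g^2 + S^-1 int G^2 <= S int g^2 + int H^2], and
    [int H^2] can be subtracted because [m] is finite and [H] bounded. *)
Lemma schur_test :
  (\int[m]_z (H z ^+ 2)%:E <= (S * \int[l]_t (g t ^+ 2))%:E)%E.
Proof.
rewrite -[leLHS]fineK; first by rewrite lee_fin; exact: schur_test_fin.
exact: (integrable_fin_num measurableT iH2).
Qed.

End fixed_function.
End schur.

(** * Borel sets of the complex plane and integrals of damped exponentials *)

Section borel_complex.
Variable R : realType.
Implicit Types z w : R[i].

Lemma Re_le_normc z : `|complex.Re z| <= normc z.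
Proof.
case: z => a b /=; rewrite -sqrtr_sqr ler_wsqrtr//.
by rewrite lerDl sqr_ge0.
Qed.

Lemma Im_le_normc z : `|complex.Im z| <= normc z.
Proof.
case: z => a b /=; rewrite -sqrtr_sqr ler_wsqrtr//.
by rewrite lerDr sqr_ge0.
Qed.

Lemma normc_le z : normc z <= `|complex.Re z| + `|complex.Im z|.
Proof.
case: z => a b /=; rewrite -[leRHS]ger0_norm ?addr_ge0// -sqrtr_sqr.
rewrite ler_wsqrtr// sqrrD !real_normK ?num_real//.
by rewrite lerD2r lerDl mulrn_wge0// mulr_ge0.
Qed.

(** Balls of [R[i]^o] have complex radii; only the positive reals among them
    count. *)
Lemma open_gt_complex (g : R[i] -> R) (a : R) :
  (forall z w, `|g z - g w| <= normc (z - w)) ->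
  @open (R[i]^o) [set z | a < g z].
Proof.
move=> g1; rewrite openE => z /= az.
apply/nbhs_ballP; exists ((g z - a)%:C)%C => /=.
  by rewrite ltcE/= eqxx/= subr_gt0.
move=> w; rewrite /ball/= normc_def ltcE/= eqxx/= => zw.
have := le_lt_trans (g1 z w) _.
rewrite /normc; move: zw; case: (z) (w) => [? ?] [? ?]/= zw /(_ _ zw).
by rewrite ltr_norml => /andP[_]; lra.
Qed.

(** Rays generate the Borel sets of the line, so continuity of [g], here in
    Lipschitz form, suffices. *)
Lemma measurable_lip_complex (g : R[i] -> R) :
  (forall z w, `|g z - g w| <= normc (z - w)) ->
  measurable_fun [set: borelC R] (g : borelC R -> R).
Proof.
move=> g1; apply: (measurability (@RGenOInfty.G R)).
  exact: RGenOInfty.measurableE.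
move=> _ [_ [a ->] <-]; rewrite setTI.
apply: sub_sigma_algebra.
rewrite (_ : _ @^-1` _ = [set z | a < g z]); first exact: open_gt_complex.
by apply/seteqP; split => z /=; rewrite in_itv/= andbT.
Qed.

Lemma measurable_Re : measurable_fun [set: borelC R] (@complex.Re R : borelC R -> R).
Proof.
apply: measurable_lip_complex => z w.
by apply: le_trans (Re_le_normc _); case: z w => [? ?] [? ?].
Qed.

Lemma measurable_Im : measurable_fun [set: borelC R] (@complex.Im R : borelC R -> R).
Proof.
apply: measurable_lip_complex => z w.
by apply: le_trans (Im_le_normc _); case: z w => [? ?] [? ?].
Qed.

End borel_complex.

Section exponential_integrals.
Variable R : realType.
Notation mu := (@lebesgue_measure R).

Lemma measurable_posreals : measurable (posreals R).
Proof. exact: measurable_itv. Qed.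

Lemma cvg_expRM (s : R) : 0 < s -> expR (- (s * t)) @[t --> +oo] --> (0 : R).
Proof.
move=> s0.
have h : (s * t) @[t --> +oo] --> +oo by apply: gt0_cvgMry => //; exact: cvg_id.
exact: (cvg_comp _ _ h (@cvgr_expR R)).
Qed.

Lemma continuous_expRM (s : R) : continuous (fun t => expR (- (s * t))).
Proof.
move=> t; apply: continuous_comp; last exact: continuous_expR.
by apply: cvgN; apply: cvgMr; exact: cvg_id.
Qed.

Lemma integral_expR (s : R) : 0 < s ->
  (\int[mu]_(t in posreals R) (expR (- (s * t)))%:E)%E = (s^-1)%:E.
Proof.
move=> s0.
rewrite integral_itv_obnd_cbnd; last first.
  apply/measurable_EFinP; apply: measurable_funTS.
  apply: continuous_measurable_fun; exact: continuous_expRM.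
rewrite (@ge0_continuous_FTC2y _ _ (fun t => - s^-1 * expR (- (s * t))) 0 0).
- by rewrite mulr0 oppr0 expR0 mulr1 -EFinB sub0r opprK.
- by move=> t _; exact: expR_ge0.
- apply: continuous_subspaceT; exact: continuous_expRM.
- by rewrite -[X in _ --> X](mulr0 (- s^-1)); apply: cvgMr; exact: cvg_expRM.
- by move=> t _; apply: ex_derive.
- apply: cvg_at_right_filter.
  by apply: cvgMr; exact: continuous_expRM.
- move=> t _; rewrite derive1E derive_val /GRing.scale/=; field.
  by rewrite gt_eqF.
Qed.

(** The factor [1 + cos] keeps the integrand nonnegative, so that the improper
    fundamental theorem for nonnegative functions applies; subtracting the
    integral of the exponential leaves the cosine. *)
Lemma integral_expR1cos (s y : R) : 0 < s ->
  (\int[mu]_(t in posreals R) (expR (- (s * t)) * (1 + cos (y * t)))%:E)%E =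
  (s^-1 + s / (s ^+ 2 + y ^+ 2))%:E.
Proof.
move=> s0.
have s2 : 0 < s ^+ 2 + y ^+ 2 by rewrite ltr_pwDl ?sqr_ge0 ?exprn_gt0.
have cc : continuous (fun t => expR (- (s * t)) * (1 + cos (y * t))).
  move=> t; apply: cvgM; first exact: continuous_expRM.
  apply: cvgD; first exact: cvg_cst.
  apply: continuous_comp; last exact: continuous_cos.
  by apply: cvgMr; exact: cvg_id.
rewrite integral_itv_obnd_cbnd; last first.
  apply/measurable_EFinP; apply: measurable_funTS.
  exact: continuous_measurable_fun.
pose F t := expR (- (s * t)) *
   (- s^-1 + (s ^+ 2 + y ^+ 2)^-1 * (y * sin (y * t) - s * cos (y * t))).
have dF (t : R) : is_derive t 1 F (expR (- (s * t)) * (1 + cos (y * t))).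
  rewrite /F; apply: is_derive_eq.
  rewrite /GRing.scale/=; field.
  by rewrite !gt_eqF.
rewrite (@ge0_continuous_FTC2y _ _ F 0 0).
- rewrite /F !mulr0 oppr0 expR0 sin0 cos0 -EFinB; congr EFin.
  by field; rewrite !gt_eqF.
- by move=> t _; rewrite mulr_ge0 ?expR_ge0//.
- exact: continuous_subspaceT.
- rewrite /F.
  pose K := s^-1 + (s ^+ 2 + y ^+ 2)^-1 * (`|y| + s).
  have FK t : `|F t| <= K * expR (- (s * t)).
    rewrite /F normrM [leRHS]mulrC ger0_norm ?expR_ge0// ler_wpM2l ?expR_ge0//.
    rewrite /K (le_trans (ler_normD _ _))// lerD//.
      by rewrite normrN ger0_norm// invr_ge0 ltW.
    have i0 : 0 <= (s ^+ 2 + y ^+ 2)^-1 by rewrite invr_ge0 ltW.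
    rewrite normrM (ger0_norm i0); apply: ler_wpM2l => //.
    rewrite (le_trans (ler_normB _ _))// !normrM (gtr0_norm s0) lerD//.
      by rewrite ler_piMr// ler_norml sin_geN1 sin_le1.
    by rewrite ler_piMr ?(ltW s0)// ler_norml cos_geN1 cos_le1.
  have K0 : K * expR (- (s * t)) @[t --> +oo] --> (0 : R).
    by rewrite -[X in _ --> X](mulr0 K); apply: cvgMr; exact: cvg_expRM.
  apply: (@squeeze_cvgr _ _ _ _ (fun t => - (K * expR (- (s * t))))
     (fun t => K * expR (- (s * t)))) => //.
    by apply: nearW => t; rewrite -ler_norml; exact: FK.
  by rewrite -[X in _ --> X]oppr0; exact: cvgN.
- by move=> t _; apply: ex_derive.
- apply: cvg_at_right_filter.
  have : {for 0, continuous F}.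
    by apply: differentiable_continuous; apply/derivable1_diffP; apply: ex_derive.
  by [].
- by move=> t _; rewrite derive1E derive_val.
Qed.

End exponential_integrals.

(** * Carleson measures on a strip and the decay of the Poisson kernel *)

Section exp_integrable.
Variable R : realType.
Notation mu := (@lebesgue_measure R).

Lemma measurable_expRM (D : set R) (s : R) : measurable_fun D (fun t : R => expR (- (s * t))).
Proof.
apply: measurable_funTS; apply: continuous_measurable_fun.
exact: continuous_expRM.
Qed.

Lemma integrable_expR (s : R) : 0 < s ->
  mu.-integrable (posreals R) (fun t => (expR (- (s * t)))%:E).
Proof.
move=> s0; apply/integrableP; split.
  by apply/measurable_EFinP; exact: measurable_expRM.
under eq_integral do rewrite /= ger0_norm ?expR_ge0//.
by rewrite integral_expR// ltry.
Qed.

Lemma measurable_cosM (D : set R) (y : R) : measurable_fun D (fun t : R => cos (y * t)).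
Proof.
apply: measurable_funTS; apply: continuous_measurable_fun => t.
apply: continuous_comp; last exact: continuous_cos.
by apply: cvgMr; exact: cvg_id.
Qed.

Lemma integrable_expRcos (s y : R) : 0 < s ->
  mu.-integrable (posreals R) (fun t => (expR (- (s * t)) * cos (y * t))%:E).
Proof.
move=> s0; apply: (@Rintegrable_le _ _ _ mu (posreals R) _ (fun t => expR (- (s * t)))).
- exact: measurable_posreals.
- by apply: measurable_funM; [exact: measurable_expRM|exact: measurable_cosM].
- move=> t _; rewrite normrM ger0_norm ?expR_ge0// ler_piMr ?expR_ge0//.
  by rewrite ler_norml cos_geN1 cos_le1.
- exact: integrable_expR.
Qed.

(** The real part of [1 / (s + iy)]: the Poisson kernel of the half-plane. *)
Lemma Rintegral_expRcos (s y : R) : 0 < s ->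
  \int[mu]_(t in posreals R) (expR (- (s * t)) * cos (y * t)) =
  s / (s ^+ 2 + y ^+ 2).
Proof.
move=> s0.
have h : \int[mu]_(t in posreals R) (expR (- (s * t)) * (1 + cos (y * t))) =
    s^-1 + s / (s ^+ 2 + y ^+ 2) by rewrite /Rintegral integral_expR1cos.
have h1 : \int[mu]_(t in posreals R) expR (- (s * t)) = s^-1.
  by rewrite /Rintegral integral_expR.
apply: (addrI s^-1); rewrite -h -h1 -RintegralD; last 3 first.
- exact: measurable_posreals.
- exact: integrable_expR.
- exact: integrable_expRcos.
by apply: eq_Rintegral => t _; rewrite mulrDr mulr1.
Qed.

End exp_integrable.

Section frestr.
Context d (T : measurableType d) (R : realType).
Variables (mu : {measure set T -> \bar R}) (D : set T) (mD : measurable D).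
Hypothesis moo : (mu D < +oo)%E.

Lemma ge0_integral_mfrestr (f : T -> \bar R) :
  measurable_fun setT f -> (forall x, 0 <= f x)%E ->
  (\int[mfrestr mD moo]_x f x = \int[mu]_(x in D) f x)%E.
Proof.
move=> mf f0.
rewrite [LHS](@ge0_negligible_integral _ _ _ _ _ (~` D))//; last 2 first.
- exact: measurableC.
- by transitivity (mu (~` D `&` D)) => //; rewrite setICl measure0.
rewrite setDE setTI setCK.
apply: eq_measure_integral => A mA AD.
by transitivity (mu (A `&` D)) => //; rewrite setIidl.
Qed.

End frestr.

Section carleson.
Variable R : realType.
Variables (mu : {measure set (borelC R) -> \bar R}) (a1 a2 C r : R).
Hypothesis a1_gt0 : 0 < a1.
Hypothesis a12 : a1 <= a2.
Hypothesis C0 : 0 < C.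
Hypothesis carleson : carleson_condition mu r C.

Let a2_gt0 : 0 < a2. Proof. exact: lt_le_trans a12. Qed.

Lemma measurable_strip : measurable (strip a1 a2 : set (borelC R)).
Proof.
rewrite (_ : strip a1 a2 = @complex.Re R @^-1` `[a1, a2]).
  rewrite -[X in measurable X]setTI.
  exact: (@measurable_Re R) measurableT _ (measurable_itv _).
by apply/seteqP; split => z /=; rewrite /strip/= in_itv.
Qed.

(** The height [2 a2] makes the Carleson square over the same interval wide
    enough, [0 < x < 2 a2], to contain the part of the strip above it. *)
Definition box (c : R) : set (borelC R) :=
  strip a1 a2 `&` [set z | c <= complex.Im z <= c + 2 * a2].

Lemma measurable_Im_itv (i : interval R) :
  measurable ([set z | complex.Im z \in i] : set (borelC R)).
Proof.
rewrite -[X in measurable X]setTI.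
exact: (@measurable_Im R) measurableT _ (measurable_itv i).
Qed.

Lemma measurable_box c : measurable (box c).
Proof.
apply: measurableI; first exact: measurable_strip.
rewrite (_ : mkset _ = [set z : borelC R | complex.Im z \in `[c, c + 2 * a2]]).
  exact: measurable_Im_itv.
by apply/seteqP; split => z /=; rewrite in_itv.
Qed.

Lemma interval_length_itv (c L : R) : 0 <= L -> interval_length `[c, c + L] = L.
Proof.
move=> L0; rewrite /interval_length lebesgue_measure_itv/= lte_fin ltrDl.
case: ifPn => [_|]; first by rewrite -EFinB/= addrAC subrr add0r.
by rewrite -leNgt => L0'; apply/esym/le_anti; rewrite L0 L0'.
Qed.

Lemma measurable_carleson_square (I : set R) : is_interval I ->
  measurable (carleson_square I : set (borelC R)).
Proof.
move=> itvI.
rewrite (_ : carleson_square I = (@complex.Im R @^-1` I) `&`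
  (@complex.Re R @^-1` `]0, interval_length I[)).
  apply: measurableI; rewrite -[X in measurable X]setTI.
    exact: (@measurable_Im R) measurableT _ (is_interval_measurable itvI).
  exact: (@measurable_Re R) measurableT _ (measurable_itv _).
by apply/seteqP; split => z /=; rewrite /carleson_square/= in_itv.
Qed.

Lemma box_measure c : (mu (box c) <= (C * (2 * a2) `^ r)%:E)%E.
Proof.
have L0 : 0 <= 2 * a2 by rewrite mulr_ge0// ltW.
have := carleson (@interval_is_interval _ `[c, c + 2 * a2]) (compact_bounded (@segment_compact _ _ _)).
rewrite interval_length_itv//; apply: le_trans.
apply: le_measure; rewrite ?inE.
- exact: measurable_box.
- by apply: measurable_carleson_square; exact: interval_is_interval.
- move=> z [/= /andP[az za] /andP[cz zc]]; split => /=.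
    by rewrite in_itv/= cz zc.
  rewrite interval_length_itv// (lt_le_trans a1_gt0 az)/= (le_lt_trans za)//.
  by rewrite ltr_pMl// ltr1n.
Qed.

Definition band (y : R) (n : nat) : set (borelC R) := strip a1 a2 `&`
  [set z | n%:R * (2 * a2) <= `|complex.Im z - y| < n.+1%:R * (2 * a2)].

Lemma measurable_band y n : measurable (band y n).
Proof.
apply: measurableI; first exact: measurable_strip.
have mf : measurable_fun setT (fun z : borelC R => `|complex.Im z - y|).
  apply: measurableT_comp => //; apply: measurable_funB => //.
  exact: measurable_Im.
rewrite (_ : mkset _ = (fun z : borelC R => `|complex.Im z - y|) @^-1`
   `[n%:R * (2 * a2), n.+1%:R * (2 * a2)[).
  rewrite -[X in measurable X]setTI.
  exact: mf measurableT _ (measurable_itv _).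
by apply/seteqP; split => z /=; rewrite in_itv.
Qed.

(** A band is the union of two boxes, one above and one below [y]. *)
Lemma band_measure y n : (mu (band y n) <= (2 * (C * (2 * a2) `^ r))%:E)%E.
Proof.
have sub : band y n `<=` box (y + n%:R * (2 * a2)) `|` box (y - n.+1%:R * (2 * a2)).
  move=> z [sz /= /andP[nz zn]].
  have [yz|zy] := leP 0 (complex.Im z - y).
    left; split => //=; move: nz zn; rewrite ger0_norm// -natr1; lra.
  right; split => //=; move: nz zn; rewrite ltr0_norm// -natr1; lra.
apply: (@le_trans _ _ (mu (box (y + n%:R * (2 * a2)) `|` box (y - n.+1%:R * (2 * a2))))).
  apply: le_measure; rewrite ?inE//; first exact: measurable_band.
  by apply: measurableU; exact: measurable_box.
rewrite (le_trans (measureU2 _ _ _))//; [exact: measurable_box|exact: measurable_box|].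
by rewrite [2 * (C * _)]mulr_natl mulr2n EFinD leeD// box_measure.
Qed.

Lemma bigcup_band y : \bigcup_n band y n = strip a1 a2.
Proof.
apply/seteqP; split => z /=; first by move=> [n _ []].
move=> sz; pose x := `|complex.Im z - y| / (2 * a2).
have x0 : 0 <= x by rewrite divr_ge0// mulr_ge0// ltW.
exists (Num.truncn x) => //; split => //=.
have := truncn_itv x0; rewrite /x ler_pdivlMr ?ltr_pdivrMr ?mulr_gt0//.
Qed.

Lemma trivIset_band y : trivIset setT (band y).
Proof.
apply/trivIsetP => i j _ _; wlog ij : i j / (i < j)%N.
  move=> h; rewrite neq_ltn => /orP[ij|ji]; first by apply: h => //; rewrite lt_eqF.
  by rewrite setIC; apply: h => //; rewrite lt_eqF.
move=> _; apply/seteqP; split => // z [[_ /andP[_ zi]] [_ /andP[jz _]]].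
have := le_lt_trans jz zi; rewrite ltr_pM2r ?mulr_gt0// ltr_nat ltnS.
by rewrite leqNgt ij.
Qed.

(** Twice the mass [2 C (2 a2)^r] of a band, times the height
    [2 a2 / a1^2] of the kernel, times 3 for the sum over the bands. *)
Definition schur_const : R := 12 * (C * (2 * a2) `^ r) * (a2 / a1 ^+ 2).

(** The series telescopes: [1 / (i (i + 1)) = 1 / i - 1 / (i + 1)]. *)
Lemma sum_inv_consecutive_le n :
  \sum_(0 <= i < n) (3 / (i.+1%:R * i.+2%:R) : R) <= 3.
Proof.
suff -> : \sum_(0 <= i < n) (3 / (i.+1%:R * i.+2%:R) : R) = 3 - 3 / n.+1%:R.
  by rewrite lerBlDr lerDl divr_ge0.
elim: n => [|n IH]; first by rewrite big_nil divr1 subrr.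
rewrite big_nat_recr//= IH -[n.+2%:R]natr1 -[n.+1%:R]natr1; field.
have n0 : (0 : R) <= n%:R by [].
by apply/andP; split; rewrite gt_eqF//; lra.
Qed.

(** Since [a1 <= 2 a2], the left side is at most [2 a2 / (a1^2 (1 + n^2))], and
    [(n + 1) (n + 2) <= 3 (1 + n^2)] for every integer [n], which amounts to
    [0 <= (2 n - 1) (n - 1)]. *)
Lemma band_decay n (t : R) : n%:R * (2 * a2) <= t ->
  2 * a2 / (a1 ^+ 2 + t ^+ 2) <= 2 * a2 / a1 ^+ 2 * (3 / (n.+1%:R * n.+2%:R)).
Proof.
move=> nt.
have nt' : n%:R * a1 <= t.
  apply: le_trans nt; apply: ler_wpM2l => //; move: a12 a2_gt0; lra.
have t2 : n%:R ^+ 2 * a1 ^+ 2 <= t ^+ 2.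
  by rewrite -exprMn ler_pXn2r ?nnegrE ?(le_trans _ nt')// mulr_ge0// ltW.
rewrite -[leRHS]mulrA ler_wpM2l ?mulr_ge0 ?(ltW a2_gt0)//.
have a12_gt0 : 0 < a1 ^+ 2 by rewrite exprn_gt0.
have n0 : (0 : R) <= n%:R by [].
have n1 : (0 : R) <= (2 * n%:R - 1) * (n%:R - 1).
  case: (n) => [|m]; first by rewrite mulr0 !sub0r mulrNN mulr1.
  by rewrite -[m.+1%:R]natr1 addrK mulr_ge0//; have := ler0n R m; lra.
rewrite -(natr1 n.+1) -(natr1 n); move: a12_gt0 t2 n0 n1.
move: (a1 ^+ 2) (t ^+ 2) (n%:R) => b u m b0 mu_ m0 m1.
have mb : 0 <= b * ((2 * m - 1) * (m - 1)) by rewrite mulr_ge0// ltW.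
have -> : b^-1 * (3 / ((m + 1) * (m + 1 + 1))) =
    (b * ((m + 1) * (m + 1 + 1)) / 3)^-1.
  by field; rewrite !gt_eqF//; lra.
rewrite lef_pV2 ?posrE; [| |rewrite !(mulr_gt0, divr_gt0)//; lra].
- rewrite ler_pdivrMr//; nra.
- nra.
Qed.

(** Sum the bound of [band_decay] over the bands around [y]. *)
Lemma strip_decay_integral (y : R) (g : borelC R -> R) :
  measurable_fun setT g -> (forall z, 0 <= g z) ->
  (forall z, strip a1 a2 z -> g z <= 2 * a2 / (a1 ^+ 2 + (complex.Im z - y) ^+ 2)) ->
  (\int[mu]_(z in strip a1 a2) (g z)%:E <= schur_const%:E)%E.
Proof.
move=> mg g0 gle.
have mg' D : measurable_fun D (fun z => (g z)%:E).
  by apply: measurable_funTS; exact/measurable_EFinP.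
rewrite -(bigcup_band y) ge0_integral_bigcup//; last 3 first.
- by move=> n; exact: measurable_band.
- by move=> z _; rewrite lee_fin.
- exact: trivIset_band.
pose K := 2 * (C * (2 * a2) `^ r) * (2 * a2 / a1 ^+ 2).
have K0 : 0 <= K.
  by rewrite !mulr_ge0 ?invr_ge0 ?powR_ge0 ?sqr_ge0 ?(ltW C0) ?(ltW a2_gt0).
have leb n : (\int[mu]_(z in band y n) (g z)%:E <=
    (K * (3 / (n.+1%:R * n.+2%:R)))%:E)%E.
  pose c := 2 * a2 / a1 ^+ 2 * (3 / (n.+1%:R * n.+2%:R)).
  have c0 : 0 <= c.
    by rewrite /c !mulr_ge0 ?invr_ge0 ?sqr_ge0 ?(ltW a2_gt0) ?mulr_ge0 ?ler0n.
  apply: (@le_trans _ _ (\int[mu]_(z in band y n) c%:E)%E).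
    apply: ge0_le_integral => //; first exact: measurable_band.
    - by move=> z _; rewrite lee_fin.
    - move=> z [sz /= /andP[nz _]]; rewrite lee_fin (le_trans (gle z sz))//.
      by rewrite -(real_normK (num_real (_ - y))) band_decay.
  rewrite integral_cst//; last exact: measurable_band.
  rewrite (le_trans (lee_wpmul2l _ (band_measure y n)))//.
  rewrite -EFinM lee_fin /K /c.
  by rewrite [leLHS]mulrC [leLHS]mulrA.
apply: lime_le.
  by apply: is_cvg_nneseries => n _ _; apply: integral_ge0 => z _; rewrite lee_fin.
apply: nearW => n.
apply: (@le_trans _ _ (\sum_(0 <= i < n) (K * (3 / (i.+1%:R * i.+2%:R)))%:E)%E).
  by apply: lee_sum => i _; exact: leb.
rewrite sumEFin lee_fin -mulr_sumr (le_trans (ler_wpM2l K0 (sum_inv_consecutive_le n)))//.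
rewrite /K /schur_const; lra.
Qed.

End carleson.

(** * The weighted square-integrable estimate for damped cosine and sine transforms *)

Lemma fine_le_EFin (R : realType) (x : \bar R) (c : R) :
  (0 <= x)%E -> (x <= c%:E)%E -> fine x <= c.
Proof. by case: x => [r| |]//=; rewrite leye_eq. Qed.

(** With [phi] the cosine or the sine, these are the real transforms out of
    which the Laplace transform is made. *)
Definition osc_transform (R : realType) (phi f : R -> R) (z : R[i]) : R :=
  \int[@lebesgue_measure R]_(t in posreals R)
    (expR (- (complex.Re z * t)) * phi (complex.Im z * t) * f t).

Definition halfplane_poisson (R : realType) (s y : R) : R := s / (s ^+ 2 + y ^+ 2).

Section poisson.
Context d (T : measurableType d) (R : realType).

Lemma halfplane_poisson_ge0 (s y : R) : 0 <= s -> 0 <= halfplane_poisson s y.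
Proof. by move=> s0; rewrite divr_ge0// addr_ge0 ?sqr_ge0. Qed.

(** Inversion is treated as the power with exponent [-1], which is measurable. *)
Lemma measurable_poisson (s y : T -> R) :
  measurable_fun setT s -> measurable_fun setT y ->
  measurable_fun setT (fun w => halfplane_poisson (s w) (y w)).
Proof.
move=> ms my; apply: measurable_funM => //.
have -> : (fun w => (s w ^+ 2 + y w ^+ 2)^-1) =
    (fun w => powR (s w ^+ 2 + y w ^+ 2) (-1)).
  by apply/funext => w; rewrite powR_inv1// addr_ge0 ?sqr_ge0.
apply: (measurableT_comp (measurable_powR _)).
by apply: measurable_funD; exact: measurable_funX.
Qed.

End poisson.

Lemma lebesgue_Rintegral_indic (R : realType) (D : set R) (f : R -> R) :
  \int[@lebesgue_measure R]_t (\1_D t * f t) =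
  \int[@lebesgue_measure R]_(t in D) f t.
Proof.
rewrite [RHS]Rintegral_mkcond patch_indic.
by apply: eq_Rintegral => t _; rewrite mulrC.
Qed.

Section l2_bound.
Variable R : realType.
Notation leb := (@lebesgue_measure R).
Variables (mu : {measure set (borelC R) -> \bar R}) (a1 a2 C r : R).
Hypothesis a1_gt0 : 0 < a1.
Hypothesis a12 : a1 <= a2.
Hypothesis C0 : 0 < C.
Hypothesis carleson : carleson_condition mu r C.
Let S := schur_const a1 a2 C r.

Variables (phi : R -> R) (e : R).
Hypothesis mphi : measurable_fun setT phi.
Hypothesis phi1 : forall t, `|phi t| <= 1.
Hypothesis e1 : `|e| <= 1.
Hypothesis phiM : forall u v, phi u * phi v = 2^-1 * (cos (u - v) + e * cos (u + v)).

Variable f : R -> R.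
Hypothesis mf : measurable_fun (posreals R) f.
Hypothesis if2 : leb.-integrable (posreals R) (fun t => (f t ^+ 2 * expR (- (a1 * t)))%:E).

Let a2_gt0 : 0 < a2. Proof. exact: lt_le_trans a12. Qed.

Lemma schur_const_gt0 : 0 < S.
Proof.
by rewrite /S /schur_const !mulr_gt0 ?powR_gt0 ?invr_gt0 ?exprn_gt0 ?mulr_gt0.
Qed.

(** Bounded pieces of the strip have finite mass, as Fubini requires. *)
Definition cut_strip (n : nat) : set (borelC R) :=
  strip a1 a2 `&` [set z | - n%:R <= complex.Im z <= n%:R].

Lemma measurable_cut_strip n : measurable (cut_strip n).
Proof.
apply: measurableI; first exact: measurable_strip.
rewrite (_ : mkset _ = [set z : borelC R | complex.Im z \in `[- n%:R, n%:R]]).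
  exact: measurable_Im_itv.
by apply/seteqP; split => z /=; rewrite in_itv.
Qed.

Lemma cut_strip_finite n : (mu (cut_strip n) < +oo)%E.
Proof.
pose m := n%:R + a2.
have m0 : 0 < m by rewrite ltr_wpDl.
have len : interval_length `[- m, - m + (m + m)] = m + m.
  by apply: interval_length_itv; rewrite addr_ge0// ltW.
have itv : is_interval `[- m, - m + (m + m)] by exact: interval_is_interval.
have := carleson itv (compact_bounded (@segment_compact _ _ _)).
rewrite len => h; apply: le_lt_trans (le_trans _ h) (ltry _).
apply: le_measure; rewrite ?inE.
- exact: measurable_cut_strip.
- exact: measurable_carleson_square.
- move=> z [/= /andP[az za] /andP[nz zn]]; split => /=.
    by rewrite in_itv/= addrA addNr add0r /m; move: a2_gt0 => ?; apply/andP; split; lra.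
  rewrite len (lt_le_trans a1_gt0 az)/= (le_lt_trans za)//.
  by rewrite /m; have := ler0n R n; move: a2_gt0; lra.
Qed.

Section cut.
Variable n : nat.
Let E := cut_strip n.
Let m := mfrestr (measurable_cut_strip n) (cut_strip_finite n).
Let chi : measurableTypeR R -> R := \1_(posreals R).

Let k (x : borelC R * measurableTypeR R) : R := \1_E x.1 *
  (chi x.2 * (expR (- ((complex.Re x.1 - a1 / 2) * x.2)) * phi (complex.Im x.1 * x.2))).
Let h (t : measurableTypeR R) : R := chi t * expR (- (a1 / 2 * t)).
Let g (t : measurableTypeR R) : R := chi t * (f t * expR (- (a1 / 2 * t))).

Let mchi : measurable_fun setT chi.
Proof. by apply: measurable_indic; exact: measurable_posreals. Qed.

Let mRe1 : measurable_fun setT (fun x : borelC R * measurableTypeR R => complex.Re x.1).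
Proof. exact: (measurableT_comp (@measurable_Re R)). Qed.

Let mIm1 : measurable_fun setT (fun x : borelC R * measurableTypeR R => complex.Im x.1).
Proof. exact: (measurableT_comp (@measurable_Im R)). Qed.

Let m2 : measurable_fun setT (fun x : borelC R * measurableTypeR R => x.2).
Proof. exact: measurable_snd. Qed.

Let mk : measurable_fun setT k.
Proof.
apply: measurable_funM.
  have mE : measurable_fun setT (\1_E : borelC R -> R).
    by apply: measurable_indic; exact: measurable_cut_strip.
  exact: (measurableT_comp mE).
apply: measurable_funM; first exact: (measurableT_comp mchi).
apply: measurable_funM.
  apply: measurableT_comp => //; apply: measurableT_comp => //.
  by apply: measurable_funM => //; exact: measurable_funB.
by apply: (measurableT_comp mphi); exact: measurable_funM.
Qed.

Let indicE01 (D : set (borelC R)) z : \1_D z = 0 :> R \/ D z /\ \1_D z = 1 :> R.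
Proof.
rewrite indicE; have [zD|zD] := boolP (z \in D); last by left.
by right; split => //; rewrite inE in zD.
Qed.

Let chi01 t : chi t = 0 \/ 0 < t /\ chi t = 1.
Proof.
rewrite /chi indicE; have [tD|tD] := boolP (t \in posreals R); last by left.
by right; split => //; move: tD; rewrite inE /posreals/= in_itv/= andbT.
Qed.

Let kh z t : `|k (z, t)| <= h t.
Proof.
rewrite /k /h/=; have [->|[t0 ->]] := chi01 t.
  by rewrite !mul0r mulr0 normr0.
rewrite !mul1r; have [->|[/= [/andP[az _] _] ->]] := indicE01 E z.
  by rewrite mul0r normr0 expR_ge0.
rewrite mul1r normrM ger0_norm ?expR_ge0// -[leRHS]mulr1 ler_pM ?expR_ge0//.
by rewrite ler_expR lerN2 ler_wpM2r ?(ltW t0)//; lra.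
Qed.

Let h1 t : h t <= 1.
Proof.
rewrite /h; have [->|[t0 ->]] := chi01 t; first by rewrite mul0r.
rewrite mul1r -expR0 ler_expR oppr_le0 mulr_ge0 ?(ltW t0)//.
by rewrite divr_ge0// ltW.
Qed.

Let integrable_chi (F : R -> R) :
  leb.-integrable (posreals R) (fun t => (F t)%:E) ->
  leb.-integrable setT (fun t => (chi t * F t)%:E).
Proof.
move=> iF.
rewrite (_ : (fun t => _) = (EFin \o F) \_ (posreals R)).
  exact: (proj1 (@integrable_mkcond _ _ R leb (posreals R) (EFin \o F) (@measurable_posreals R)) iF).
by rewrite epatch_indic; apply/funext => t /=; rewrite -EFinM mulrC.
Qed.

Let ih : leb.-integrable setT (EFin \o h).
Proof. by apply: integrable_chi; apply: integrable_expR; rewrite divr_gt0. Qed.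

Let mg : measurable_fun setT g.
Proof.
rewrite (_ : g = (fun t => f t * expR (- (a1 / 2 * t))) \_ (posreals R)).
  apply/(measurable_restrictT _ (@measurable_posreals R)).
  by apply: measurable_funM => //; exact: measurable_expRM.
by rewrite patch_indic; apply/funext => t /=; rewrite /g mulrC.
Qed.

Let g2E t : g t ^+ 2 = chi t * (f t ^+ 2 * expR (- (a1 * t))).
Proof.
rewrite /g; have [->|[t0 ->]] := chi01 t; first by rewrite !mul0r expr0n.
rewrite !mul1r exprMn; congr (_ * _).
by rewrite expr2 -expRD; congr expR; field.
Qed.

Let ig : leb.-integrable setT (fun t => (g t ^+ 2)%:E).
Proof. by under eq_fun do rewrite g2E; exact: integrable_chi. Qed.

Let kappaE z w : \int[leb]_t (k (z, t) * k (w, t)) =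
  \1_E z * \1_E w * (2^-1 *
   (halfplane_poisson (complex.Re z + complex.Re w - a1) (complex.Im w - complex.Im z) +
    e * halfplane_poisson (complex.Re z + complex.Re w - a1) (complex.Im w + complex.Im z))).
Proof.
have [Ez|[[/andP[az _] _] Ez]] := indicE01 E z.
  rewrite Ez !mul0r (_ : (fun _ => _) = cst 0) ?Rintegral_cst// ?mul0r//.
  by apply/funext => t; rewrite /k/= Ez !mul0r.
have [Ew|[[/andP[aw _] _] Ew]] := indicE01 E w.
  rewrite Ew mulr0 !mul0r (_ : (fun _ => _) = cst 0) ?Rintegral_cst// ?mul0r//.
  by apply/funext => t; rewrite /k/= Ew mul0r mulr0.
rewrite Ez Ew !mul1r.
set s := complex.Re z + complex.Re w - a1.
have s0 : 0 < s by rewrite /s; move: a1_gt0; lra.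
transitivity (\int[leb]_t (chi t * (2^-1 * (expR (- (s * t)) * cos ((complex.Im w - complex.Im z) * t)) +
    2^-1 * e * (expR (- (s * t)) * cos ((complex.Im w + complex.Im z) * t))))).
  apply: eq_Rintegral => t _; rewrite /k/= Ez Ew !mul1r.
  have [->|[t0 ->]] := chi01 t; first by rewrite !mul0r.
  rewrite !mul1r mulrACA -expRD phiM.
  rewrite -mulrBl -mulrDl -[complex.Im z - _]opprB mulNr cosN.
  rewrite [complex.Im z + _]addrC.
  have -> : - ((complex.Re z - a1 / 2) * t) + - ((complex.Re w - a1 / 2) * t) = - (s * t).
    by rewrite /s; field.
  ring.
rewrite lebesgue_Rintegral_indic RintegralD; last 3 first.
- exact: measurable_posreals.
- apply: RintegrableZl; [exact: measurable_posreals|exact: integrable_expRcos].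
- apply: RintegrableZl; [exact: measurable_posreals|exact: integrable_expRcos].
rewrite !RintegralZl ?Rintegral_expRcos//; last 4 first.
- exact: measurable_posreals.
- exact: integrable_expRcos.
- exact: measurable_posreals.
- exact: integrable_expRcos.
by rewrite -mulrA -mulrDr.
Qed.

Let poisson_le s t : a1 <= s <= 2 * a2 ->
  halfplane_poisson s t <= 2 * a2 / (a1 ^+ 2 + t ^+ 2).
Proof.
move=> /andP[as_ sa].
have s0 : 0 < s by exact: lt_le_trans as_.
have p1 : 0 < a1 ^+ 2 + t ^+ 2 by rewrite ltr_pwDl ?exprn_gt0 ?sqr_ge0.
have p2 : 0 < s ^+ 2 + t ^+ 2 by rewrite ltr_pwDl ?exprn_gt0 ?sqr_ge0.
rewrite /halfplane_poisson ler_pM ?(ltW s0) ?invr_ge0 ?(ltW p2)//.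
by rewrite lef_pV2 ?posrE// lerD2r ler_pXn2r ?nnegrE// ltW.
Qed.

Let kappaS z : \int[m]_w `|\int[leb]_t (k (z, t) * k (w, t))| <= S.
Proof.
have S0 := ltW schur_const_gt0.
have [Ez|[[/andP[az za] _] Ez]] := indicE01 E z.
  rewrite (_ : (fun _ => _) = cst 0) ?Rintegral_cst// ?mul0r//.
  by apply/funext => w; rewrite kappaE Ez !mul0r normr0.
pose P c (w : borelC R) := \1_(strip a1 a2) w *
  halfplane_poisson (complex.Re z + complex.Re w - a1) (complex.Im w - c) : R.
have mP c : measurable_fun setT (P c).
  apply: measurable_funM.
    by apply: measurable_indic; exact: measurable_strip.
  apply: measurable_poisson.
    by apply: measurable_funB => //; apply: measurable_funD => //; exact: measurable_Re.
  by apply: measurable_funB => //; exact: measurable_Im.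
have P0 c w : 0 <= P c w.
  rewrite /P; have [->|[/= /andP[aw _] ->]] := indicE01 (strip a1 a2) w.
    by rewrite mul0r.
  by rewrite mul1r halfplane_poisson_ge0//; move: a1_gt0; lra.
have P_le c w : strip a1 a2 w ->
    P c w <= 2 * a2 / (a1 ^+ 2 + (complex.Im w - c) ^+ 2).
  move=> sw; rewrite /P indicE mem_set// mul1r poisson_le//.
  by move/andP: sw => [? ?]; apply/andP; split; move: a1_gt0; lra.
have iP c := strip_decay_integral a1_gt0 a12 C0 carleson (mP c) (P0 c) (P_le c).
pose Q w := 2^-1 * P (complex.Im z) w + 2^-1 * P (- complex.Im z) w.
have mZP c : measurable_fun setT (fun w => 2^-1 * P c w).
  exact: measurable_funM.
have mQ : measurable_fun setT Q by apply: measurable_funD.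
have ZP0 c w : 0 <= 2^-1 * P c w by rewrite mulr_ge0// invr_ge0.
have Q0 w : 0 <= Q w by rewrite addr_ge0.
have kQ w : `|\int[leb]_t (k (z, t) * k (w, t))| <= Q w.
  rewrite kappaE Ez mul1r /Q /P.
  have [->|[[sw _] ->]] := indicE01 E w.
    by rewrite mul0r normr0; exact: (Q0 w).
  rewrite indicE mem_set//= !mul1r -mulrDr normrM ger0_norm ?invr_ge0//.
  rewrite ler_wpM2l ?invr_ge0// opprK (le_trans (ler_normD _ _))// lerD//.
    rewrite ger0_norm// halfplane_poisson_ge0//.
    by move/andP : sw => [? ?]; move: a1_gt0; lra.
  have p0 : 0 <= halfplane_poisson (complex.Re z + complex.Re w - a1)
      (complex.Im w + complex.Im z).
    rewrite halfplane_poisson_ge0//.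
    by move/andP : sw => [? ?]; move: a1_gt0; lra.
  by rewrite normrM (ger0_norm p0) ler_piMl.
have mEQ (D : set (borelC R)) c : measurable_fun D (fun w => (2^-1 * P c w)%:E).
  by apply: measurable_funTS; exact/measurable_EFinP.
have QS : (\int[m]_w (Q w)%:E <= S%:E)%E.
  rewrite ge0_integral_mfrestr//; last first.
    exact/measurable_EFinP.
  apply: (@le_trans _ _ (\int[mu]_(w in strip a1 a2) (Q w)%:E)%E).
    apply: ge0_subset_integral => //.
    - exact: measurable_cut_strip.
    - exact: measurable_strip.
    - by apply: measurable_funTS; exact/measurable_EFinP.
    - by move=> w _; rewrite lee_fin.
    - by move=> w [].
  under eq_integral do rewrite EFinD.
  rewrite ge0_integralD//; [|exact: measurable_strip|by move=> w _; rewrite lee_fin|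
    by move=> w _; rewrite lee_fin].
  have half c : (\int[mu]_(w in strip a1 a2) (2^-1 * P c w)%:E <= (2^-1 * S)%:E)%E.
    under eq_integral do rewrite EFinM.
    rewrite ge0_integralZl_EFin//; last 3 first.
    - exact: measurable_strip.
    - by move=> w _; rewrite lee_fin.
    - by apply: measurable_funTS; exact/measurable_EFinP.
    by rewrite EFinM lee_wpmul2l// lee_fin invr_ge0.
  rewrite (le_trans (leeD (half _) (half _)))// -EFinD lee_fin.
  by rewrite -mulrDl (_ : 2^-1 + 2^-1 = 1) ?mul1r//; field.
have mkk : measurable_fun setT (fun w : borelC R => \int[leb]_t (k (z, t) * k (w, t))).
  apply: (measurable_Rintegral_r leb (F := fun x : borelC R * measurableTypeR R => k (z, x.2) * k x)).
  apply: measurable_funM => //.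
  by apply: measurableT_comp => //; exact: measurable_fun_pair.
have kS : (\int[m]_w `|\int[leb]_t (k (z, t) * k (w, t))|%:E <= S%:E)%E.
  apply: le_trans QS; apply: ge0_le_integral => //.
  - by apply/measurable_EFinP; exact: measurableT_comp.
  - exact/measurable_EFinP.
  - by move=> w _; rewrite lee_fin.
by apply: fine_le_EFin kS; exact: integral_ge0.
Qed.

(** Schur's test for the kernel [e^(-(x - a1/2) t) phi (y t)] and the function
    [f(t) e^(- a1 t / 2)]: half of the damping [e^(- a1 t)] is given to the
    kernel, which becomes square integrable in [t], and half to [f]. *)
Lemma l2_bound_cut :
  (\int[mu]_(z in cut_strip n) (osc_transform phi f z ^+ 2)%:E <=
   (S * \int[leb]_(t in posreals R) (f t ^+ 2 * expR (- (a1 * t))))%:E)%E.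
Proof.
pose H z := \int[leb]_t (k (z, t) * g t).
have HE z : H z = \1_E z * osc_transform phi f z.
  rewrite /H /osc_transform -(lebesgue_Rintegral_indic (posreals R)).
  have [Ez|[_ Ez]] := indicE01 E z.
    rewrite Ez mul0r (_ : (fun _ => _) = cst 0) ?Rintegral_cst// ?mul0r//.
    by apply/funext => t; rewrite /k/= Ez !mul0r.
  rewrite Ez mul1r; apply: eq_Rintegral => t _.
  rewrite /k /g/= Ez mul1r -/chi.
  have [->|[t0 ->]] := chi01 t; first by rewrite !mul0r.
  have -> : - (complex.Re z * t) =
      - ((complex.Re z - a1 / 2) * t) + - (a1 / 2 * t) by field.
  rewrite expRD; ring.
have mkg : measurable_fun setT (fun x : borelC R * measurableTypeR R => k x * g x.2).
  by apply: measurable_funM => //; exact: (measurableT_comp mg).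
have mH : measurable_fun setT H.
  exact: (measurable_Rintegral_r leb mkg).
have := schur_test mk kh h1 ih schur_const_gt0 kappaS mg ig.
rewrite -/H; have -> : \int[leb]_t (g t ^+ 2) =
    \int[leb]_(t in posreals R) (f t ^+ 2 * expR (- (a1 * t))).
  by rewrite -(lebesgue_Rintegral_indic (posreals R)); apply: eq_Rintegral => t _; rewrite g2E.
apply: le_trans; rewrite ge0_integral_mfrestr; last 2 first.
- by apply/measurable_EFinP; exact: measurable_funX.
- by move=> z; rewrite lee_fin sqr_ge0.
rewrite le_eqVlt; apply/orP; left; apply/eqP/eq_integral => z zE.
congr ((_ ^+ 2)%:E); transitivity (H z); last by [].
by rewrite HE indicE zE mul1r.
Qed.

End cut.

Lemma measurable_osc_transform : measurable_fun [set: borelC R] (osc_transform phi f).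
Proof.
rewrite (_ : osc_transform phi f = fun z => \int[leb]_t
   (expR (- (complex.Re z * t)) * phi (complex.Im z * t) * (f \_ (posreals R)) t)).
  apply: (measurable_Rintegral_r leb (F := fun x : borelC R * measurableTypeR R =>
    expR (- (complex.Re x.1 * x.2)) * phi (complex.Im x.1 * x.2) *
      (f \_ (posreals R)) x.2)).
  have mRe1 : measurable_fun setT (fun x : borelC R * measurableTypeR R => complex.Re x.1).
    exact: (measurableT_comp (@measurable_Re R)).
  have mIm1 : measurable_fun setT (fun x : borelC R * measurableTypeR R => complex.Im x.1).
    exact: (measurableT_comp (@measurable_Im R)).
  have m2 : measurable_fun setT (fun x : borelC R * measurableTypeR R => x.2).
    exact: measurable_snd.
  apply: measurable_funM; last first.
    apply: measurableT_comp m2.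
    exact: (proj1 (measurable_restrictT _ (@measurable_posreals R)) mf).
  apply: measurable_funM.
    apply: measurableT_comp => //; apply: measurableT_comp => //.
    exact: measurable_funM.
  by apply: (measurableT_comp mphi); exact: measurable_funM.
apply/funext => z; rewrite /osc_transform -(lebesgue_Rintegral_indic (posreals R)).
apply: eq_Rintegral => t _; rewrite patch_indic/=.
by rewrite [LHS]mulrC [RHS]mulrA.
Qed.

(** Monotone convergence along [cut_strip]. *)
Lemma l2_bound_strip :
  (\int[mu]_(z in strip a1 a2) (osc_transform phi f z ^+ 2)%:E <=
   (S * \int[leb]_(t in posreals R) (f t ^+ 2 * expR (- (a1 * t))))%:E)%E.
Proof.
have -> : strip a1 a2 = \bigcup_n cut_strip n.
  apply/seteqP; split => z /=; last by move=> [n _ []].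
  move=> sz; exists (Num.bound `|complex.Im z|) => //; split => //=.
  by rewrite -ler_norml ltW// archi_boundP.
have cvgE : (\int[mu]_(z in cut_strip n) (osc_transform phi f z ^+ 2)%:E)%E
    @[n --> \oo] --> (\int[mu]_(z in \bigcup_n cut_strip n) (osc_transform phi f z ^+ 2)%:E)%E.
  apply: ge0_nondecreasing_set_cvg_integral.
  - move=> i j ij; apply/subsetPset => z [sz /= /andP[iz zi]]; split => //=.
    have ij' : i%:R <= j%:R :> R by rewrite ler_nat.
    by apply/andP; split; lra.
  - exact: measurable_cut_strip.
  - move=> i; apply: measurable_funTS; apply/measurable_EFinP.
    by apply: measurable_funX; exact: measurable_osc_transform.
  - by move=> i z _; rewrite lee_fin sqr_ge0.
rewrite -(cvg_lim _ cvgE)//; apply: lime_le; first exact: cvgP cvgE.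
by apply: nearW => n; exact: l2_bound_cut.
Qed.

End l2_bound.

(** * The Laplace transform of complex functions *)

Section laplace.
Variable R : realType.
Notation leb := (@lebesgue_measure R).
Notation pos := (posreals R).
Implicit Types (f g : R -> R[i]) (s z : R[i]) (t : R).

Lemma normc_ge0 z : 0 <= normc z.
Proof. exact: le_trans (normr_ge0 _) (Re_le_normc z). Qed.

Lemma normc_sqr z : normc z ^+ 2 = complex.Re z ^+ 2 + complex.Im z ^+ 2.
Proof. by case: z => a b /=; rewrite sqr_sqrtr// addr_ge0 ?sqr_ge0. Qed.

Lemma Re_laplace_integrand f s t :
  complex.Re (laplace_integrand f s t) =
  expR (- (complex.Re s * t)) * cos (complex.Im s * t) * complex.Re (f t) +
  expR (- (complex.Re s * t)) * sin (complex.Im s * t) * complex.Im (f t).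
Proof.
rewrite /laplace_integrand /expC; case: s (f t) => [x y] [u v].
rewrite /= !(mul0r, mulr0, subr0, addr0, oppr0, add0r) cosN sinN.
by rewrite [t * x]mulrC [t * y]mulrC; ring.
Qed.

Lemma Im_laplace_integrand f s t :
  complex.Im (laplace_integrand f s t) =
  expR (- (complex.Re s * t)) * cos (complex.Im s * t) * complex.Im (f t) -
  expR (- (complex.Re s * t)) * sin (complex.Im s * t) * complex.Re (f t).
Proof.
rewrite /laplace_integrand /expC; case: s (f t) => [x y] [u v].
rewrite /= !(mul0r, mulr0, subr0, addr0, oppr0, add0r) cosN sinN.
by rewrite [t * x]mulrC [t * y]mulrC; ring.
Qed.

Lemma normc_laplace_integrand f s t :
  normc (laplace_integrand f s t) = expR (- (complex.Re s * t)) * normc (f t).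
Proof.
rewrite normcM; congr (_ * _); rewrite /expC normcM.
case: s => [x y]; rewrite /= !(mul0r, mulr0, subr0, addr0, oppr0, add0r).
rewrite expr0n/= addr0 sqrtr_sqr ger0_norm ?expR_ge0//.
by rewrite cosN sinN sqrrN cos2Dsin2 sqrtr1 mulr1 [t * x]mulrC.
Qed.

Lemma measurable_normc d (T : measurableType d) (D : set T) (F : T -> R[i]) :
  Defs.measurableC D F -> measurable_fun D (fun x => normc (F x)).
Proof.
move=> [m1 m2].
rewrite (_ : (fun x => normc (F x)) = (fun x => Num.sqrt
  (complex.Re (F x) ^+ 2 + complex.Im (F x) ^+ 2))).
  apply: measurableT_comp; last by apply: measurable_funD; exact: measurable_funX.
  by apply: continuous_measurable_fun; exact: sqrt_continuous.
by apply/funext => x; case: (F x).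
Qed.

Lemma measurable_sinM (D : set R) (y : R) : measurable_fun D (fun t : R => sin (y * t)).
Proof.
apply: measurable_funTS; apply: continuous_measurable_fun => t.
apply: continuous_comp; last exact: continuous_sin.
by apply: cvgMr; exact: cvg_id.
Qed.

Lemma measurable_laplace_integrand f s : Defs.measurableC pos f ->
  Defs.measurableC pos (laplace_integrand f s).
Proof.
move=> [m1 m2]; split.
  under eq_fun do rewrite Re_laplace_integrand.
  by apply: measurable_funD; apply: measurable_funM => //; apply: measurable_funM;
    first [exact: measurable_expRM | exact: measurable_cosM | exact: measurable_sinM].
under eq_fun do rewrite Im_laplace_integrand.
by apply: measurable_funB; apply: measurable_funM => //; apply: measurable_funM;
  first [exact: measurable_expRM | exact: measurable_cosM | exact: measurable_sinM].
Qed.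

Lemma measurable_laplace f : Defs.measurableC pos f ->
  Defs.measurableC [set: borelC R] (laplace f).
Proof.
move=> [m1 m2].
have mRe1 : measurable_fun setT (fun x : borelC R * measurableTypeR R => complex.Re x.1).
  exact: (measurableT_comp (@measurable_Re R)).
have mIm1 : measurable_fun setT (fun x : borelC R * measurableTypeR R => complex.Im x.1).
  exact: (measurableT_comp (@measurable_Im R)).
have mt : measurable_fun setT (fun x : borelC R * measurableTypeR R => x.2).
  exact: measurable_snd.
have mE : measurable_fun setT
    (fun x : borelC R * measurableTypeR R => expR (- (complex.Re x.1 * x.2))).
  by apply: measurableT_comp => //; apply: measurableT_comp => //; exact: measurable_funM.
have mc : measurable_fun setT
    (fun x : borelC R * measurableTypeR R => cos (complex.Im x.1 * x.2)).
  apply: measurableT_comp; last exact: measurable_funM.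
  by apply: continuous_measurable_fun; exact: continuous_cos.
have ms : measurable_fun setT
    (fun x : borelC R * measurableTypeR R => sin (complex.Im x.1 * x.2)).
  apply: measurableT_comp; last exact: measurable_funM.
  by apply: continuous_measurable_fun; exact: continuous_sin.
have key (F G : R -> R) : measurable_fun pos F -> measurable_fun pos G ->
    measurable_fun [set: borelC R] (fun z => \int[leb]_(t in pos)
      (expR (- (complex.Re z * t)) * cos (complex.Im z * t) * F t +
       expR (- (complex.Re z * t)) * sin (complex.Im z * t) * G t)).
  move=> mF mG.
  have mpos (H : R -> R) : measurable_fun pos H -> measurable_fun setT
      (fun x : borelC R * measurableTypeR R => (H \_ pos) x.2).
    move=> mH; apply: measurableT_comp mt.
    exact: (proj1 (measurable_restrictT _ (@measurable_posreals R)) mH).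
  have mFpos := mpos _ mF; have mGpos := mpos _ mG.
  rewrite (_ : (fun z => _) = fun z => \int[leb]_t
    (expR (- (complex.Re z * t)) * cos (complex.Im z * t) * (F \_ pos) t +
     expR (- (complex.Re z * t)) * sin (complex.Im z * t) * (G \_ pos) t)).
    apply: (measurable_Rintegral_r leb (F := fun x : borelC R * measurableTypeR R =>
     expR (- (complex.Re x.1 * x.2)) * cos (complex.Im x.1 * x.2) * (F \_ pos) x.2 +
     expR (- (complex.Re x.1 * x.2)) * sin (complex.Im x.1 * x.2) * (G \_ pos) x.2)).
    by apply: measurable_funD; apply: measurable_funM => //; exact: measurable_funM.
  apply/funext => z; rewrite -(lebesgue_Rintegral_indic pos).
  by apply: eq_Rintegral => t _; rewrite !patch_indic/=; ring.
split.
- rewrite (_ : (fun z => _) = fun z => \int[leb]_(t in pos)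
    (expR (- (complex.Re z * t)) * cos (complex.Im z * t) * complex.Re (f t) +
     expR (- (complex.Re z * t)) * sin (complex.Im z * t) * complex.Im (f t))).
    exact: key.
  apply/funext => z; apply: eq_Rintegral => t _; exact: Re_laplace_integrand.
- rewrite (_ : (fun z => _) = fun z => \int[leb]_(t in pos)
    (expR (- (complex.Re z * t)) * cos (complex.Im z * t) * complex.Im (f t) +
     expR (- (complex.Re z * t)) * sin (complex.Im z * t) * - complex.Re (f t))).
    by apply: key => //; exact: measurableT_comp.
  apply/funext => z; apply: eq_Rintegral => t _.
  by rewrite Im_laplace_integrand mulrN.
Qed.

Section damped.
Variables (f : R -> R[i]) (a : R).
Hypothesis mf : Defs.measurableC pos f.
Hypothesis fi : leb.-integrable pos (fun t => (normc (f t) * expR (- (a * t)))%:E).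

Lemma le_damped s t : a <= complex.Re s -> pos t ->
  expR (- (complex.Re s * t)) * normc (f t) <= normc (f t) * expR (- (a * t)).
Proof.
rewrite /posreals/= in_itv/= andbT => as_ t0.
by rewrite mulrC ler_wpM2l ?normc_ge0// ler_expR lerN2 ler_wpM2r// ltW.
Qed.

Lemma integrable_laplace_integrand s : a <= complex.Re s ->
  integrableC leb pos (laplace_integrand f s).
Proof.
move=> as_; have [m1 m2] := measurable_laplace_integrand s mf.
split; apply: (@Rintegrable_le _ _ _ leb pos _
    (fun t => normc (f t) * expR (- (a * t)))) => //.
- exact: measurable_posreals.
- move=> t t0; rewrite (le_trans (Re_le_normc _))// normc_laplace_integrand.
  exact: le_damped.
- exact: measurable_posreals.
- move=> t t0; rewrite (le_trans (Im_le_normc _))// normc_laplace_integrand.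
  exact: le_damped.
Qed.

(** The factor 2 pays for bounding the real and imaginary parts separately. *)
Lemma normc_laplace_le s : a <= complex.Re s ->
  normc (laplace f s) <= 2 * \int[leb]_(t in pos) (normc (f t) * expR (- (a * t))).
Proof.
move=> as_; have [i1 i2] := integrable_laplace_integrand as_.
rewrite (le_trans (normc_le _))// /laplace/= mulr_natl mulr2n lerD//.
- rewrite (le_trans (@le_normr_Rintegral _ _ R leb pos _ (@measurable_posreals R) i1))//.
  apply: le_Rintegral => //; [exact: measurable_posreals| |].
    exact: (integrable_norm i1).
  move=> t t0; rewrite (le_trans (Re_le_normc _))// normc_laplace_integrand.
  exact: le_damped.
- rewrite (le_trans (@le_normr_Rintegral _ _ R leb pos _ (@measurable_posreals R) i2))//.
  apply: le_Rintegral => //; [exact: measurable_posreals| |].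
    exact: (integrable_norm i2).
  move=> t t0; rewrite (le_trans (Im_le_normc _))// normc_laplace_integrand.
  exact: le_damped.
Qed.

End damped.

Section osc.
Variables (f : R -> R[i]) (a : R).
Hypothesis mf : Defs.measurableC pos f.
Hypothesis fi : leb.-integrable pos (fun t => (normc (f t) * expR (- (a * t)))%:E).

Let integrable_osc (phi : R -> R) (F : R -> R) s :
  measurable_fun setT phi -> (forall t, `|phi t| <= 1) ->
  measurable_fun pos F -> (forall t, `|F t| <= normc (f t)) ->
  a <= complex.Re s ->
  leb.-integrable pos (fun t => (expR (- (complex.Re s * t)) * phi (complex.Im s * t) * F t)%:E).
Proof.
move=> mphi phi1 mF F1 as_.
apply: (@Rintegrable_le _ _ _ leb pos _ (fun t => normc (f t) * expR (- (a * t)))) => //.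
- exact: measurable_posreals.
- apply: measurable_funM => //; apply: measurable_funM; first exact: measurable_expRM.
  apply: measurable_funTS; apply: measurableT_comp => //; exact: measurable_funM.
- move=> t t0; apply: le_trans (le_damped f as_ t0).
  rewrite -mulrA normrM ger0_norm ?expR_ge0// ler_wpM2l ?expR_ge0// normrM.
  by rewrite -[leRHS]mul1r ler_pM.
Qed.

Lemma norm_cos_le1 (t : R) : `|cos t| <= 1.
Proof. by rewrite ler_norml cos_geN1 cos_le1. Qed.

Lemma norm_sin_le1 (t : R) : `|sin t| <= 1.
Proof. by rewrite ler_norml sin_geN1 sin_le1. Qed.

Lemma measurable_cos : measurable_fun [set: R] (@cos R).
Proof. by apply: continuous_measurable_fun; exact: continuous_cos. Qed.

Lemma measurable_sin : measurable_fun [set: R] (@sin R).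
Proof. by apply: continuous_measurable_fun; exact: continuous_sin. Qed.

Lemma Re_laplace s : a <= complex.Re s -> complex.Re (laplace f s) =
  osc_transform cos (fun t => complex.Re (f t)) s +
  osc_transform sin (fun t => complex.Im (f t)) s.
Proof.
move=> as_; case: mf => m1 m2; rewrite /laplace/= -RintegralD.
- by apply: eq_Rintegral => t _; exact: Re_laplace_integrand.
- exact: measurable_posreals.
- by apply: integrable_osc => //; [exact: measurable_cos|exact: norm_cos_le1|
    move=> t; exact: Re_le_normc].
- by apply: integrable_osc => //; [exact: measurable_sin|exact: norm_sin_le1|
    move=> t; exact: Im_le_normc].
Qed.

Lemma Im_laplace s : a <= complex.Re s -> complex.Im (laplace f s) =
  osc_transform cos (fun t => complex.Im (f t)) s -
  osc_transform sin (fun t => complex.Re (f t)) s.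
Proof.
move=> as_; case: mf => m1 m2; rewrite /laplace/= -RintegralB.
- by apply: eq_Rintegral => t _; exact: Im_laplace_integrand.
- exact: measurable_posreals.
- by apply: integrable_osc => //; [exact: measurable_cos|exact: norm_cos_le1|
    move=> t; exact: Im_le_normc].
- by apply: integrable_osc => //; [exact: measurable_sin|exact: norm_sin_le1|
    move=> t; exact: Re_le_normc].
Qed.

End osc.

Lemma laplace_triangle f g h s :
  (forall t, f t = g t + h t) ->
  integrableC leb pos (laplace_integrand g s) ->
  integrableC leb pos (laplace_integrand h s) ->
  normc (laplace f s) <= normc (laplace g s) + normc (laplace h s).
Proof.
move=> fgh [g1 g2] [h1 h2].
have -> : laplace f s = laplace g s + laplace h s.
  have E t : laplace_integrand f s t = laplace_integrand g s t + laplace_integrand h s t.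
    by rewrite /laplace_integrand fgh mulrDr.
  rewrite /laplace /integralC; apply/eqP; rewrite eq_complex/=.
  rewrite -(@RintegralD _ _ R leb pos _ _ (@measurable_posreals R) g1 h1).
  rewrite -(@RintegralD _ _ R leb pos _ _ (@measurable_posreals R) g2 h2).
  by apply/andP; split; apply/eqP; apply: eq_Rintegral => t _; rewrite E;
    case: (laplace_integrand g s t) (laplace_integrand h s t) => [? ?] [? ?].
exact: le_normcD.
Qed.

Section l2.
Variables (mu : {measure set (borelC R) -> \bar R}) (a1 a2 C r : R).
Hypothesis a1_gt0 : 0 < a1.
Hypothesis a12 : a1 <= a2.
Hypothesis C0 : 0 < C.
Hypothesis carleson : carleson_condition mu r C.
Let S := schur_const a1 a2 C r.
Variable f : R -> R[i].
Hypothesis mf : Defs.measurableC pos f.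
Hypothesis fi2 : leb.-integrable pos (fun t => (normc (f t) ^+ 2 * expR (- (a1 * t)))%:E).

(** [u <= u^2 + 1] and the integrability of the exponential. *)
Lemma integrable_damped : leb.-integrable pos (fun t => (normc (f t) * expR (- (a1 * t)))%:E).
Proof.
apply: (@Rintegrable_le _ _ _ leb pos _
    (fun t => normc (f t) ^+ 2 * expR (- (a1 * t)) + expR (- (a1 * t)))).
- exact: measurable_posreals.
- by apply: measurable_funM; [exact: measurable_normc|exact: measurable_expRM].
- move=> t _; rewrite ger0_norm ?mulr_ge0 ?expR_ge0 ?normc_ge0//.
  rewrite -[X in _ + X]mul1r -mulrDl ler_wpM2r ?expR_ge0//.
  by have := sqr_ge0 (normc (f t) - 1); have := sqr_ge0 (normc (f t)); nra.
- apply: RintegrableD => //; first exact: measurable_posreals.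
  exact: integrable_expR.
Qed.

Let W := \int[leb]_(t in pos) (normc (f t) ^+ 2 * expR (- (a1 * t))).

Let osc_le (phi : R -> R) e (F : R -> R) :
  measurable_fun setT phi -> (forall t, `|phi t| <= 1) -> `|e| <= 1 ->
  (forall u v, phi u * phi v = 2^-1 * (cos (u - v) + e * cos (u + v))) ->
  measurable_fun pos F -> (forall t, `|F t| <= normc (f t)) ->
  (\int[mu]_(z in strip a1 a2) (osc_transform phi F z ^+ 2)%:E <= (S * W)%:E)%E.
Proof.
move=> mphi phi1 e1 phiM mF F1.
have FW t : F t ^+ 2 * expR (- (a1 * t)) <= normc (f t) ^+ 2 * expR (- (a1 * t)).
  by rewrite ler_wpM2r ?expR_ge0// -(real_normK (num_real (F t))) ler_pXn2r ?nnegrE ?normc_ge0.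
have iF : leb.-integrable pos (fun t => (F t ^+ 2 * expR (- (a1 * t)))%:E).
  apply: (@Rintegrable_le _ _ _ leb pos _ (fun t => normc (f t) ^+ 2 * expR (- (a1 * t)))) => //.
  - exact: measurable_posreals.
  - by apply: measurable_funM; [exact: measurable_funX|exact: measurable_expRM].
  - move=> t _; rewrite ger0_norm; first exact: FW.
    by rewrite mulr_ge0 ?expR_ge0 ?sqr_ge0.
apply: le_trans (l2_bound_strip a1_gt0 a12 C0 carleson mphi phi1 e1 phiM mF iF) _.
rewrite lee_fin ler_wpM2l//; first exact: (ltW (schur_const_gt0 _ a1_gt0 a12 C0)).
by apply: le_Rintegral => //; exact: measurable_posreals.
Qed.

(** [|L f|^2 = (c1 + s2)^2 + (c2 - s1)^2] for the cosine and sine transforms of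
    the real and imaginary parts of [f], hence at most twice the sum of four
    squares, each of which is bounded by [l2_bound_strip]. *)
Lemma laplace_l2 :
  (\int[mu]_(z in strip a1 a2) (normc (laplace f z) ^+ 2)%:E <= (8 * S * W)%:E)%E.
Proof.
have [m1 m2] := mf.
pose c1 := osc_transform cos (fun t => complex.Re (f t)).
pose s1 := osc_transform sin (fun t => complex.Re (f t)).
pose c2 := osc_transform cos (fun t => complex.Im (f t)).
pose s2 := osc_transform sin (fun t => complex.Im (f t)).
have cM (u v : R) : cos u * cos v = 2^-1 * (cos (u - v) + 1 * cos (u + v)).
  by rewrite cosB cosD; field.
have sM (u v : R) : sin u * sin v = 2^-1 * (cos (u - v) + (-1) * cos (u + v)).
  by rewrite cosB cosD; field.
have n1 : `|1 : R| <= 1 by rewrite normr1.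
have nN1 : `|-1 : R| <= 1 by rewrite normrN normr1.
have r1 t : `|complex.Re (f t)| <= normc (f t) by exact: Re_le_normc.
have r2 t : `|complex.Im (f t)| <= normc (f t) by exact: Im_le_normc.
have C1 := osc_le measurable_cos norm_cos_le1 n1 cM m1 r1.
have C2 := osc_le measurable_cos norm_cos_le1 n1 cM m2 r2.
have S1 := osc_le measurable_sin norm_sin_le1 nN1 sM m1 r1.
have S2 := osc_le measurable_sin norm_sin_le1 nN1 sM m2 r2.
have mo phi F : measurable_fun setT phi -> measurable_fun pos F ->
    measurable_fun (strip a1 a2 : set (borelC R)) (fun z => (osc_transform phi F z ^+ 2)%:E).
  move=> mphi mF; apply: measurable_funTS; apply/measurable_EFinP.
  by apply: measurable_funX; exact: measurable_osc_transform.
have mc1 := mo _ _ measurable_cos m1; have mc2 := mo _ _ measurable_cos m2.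
have ms1 := mo _ _ measurable_sin m1; have ms2 := mo _ _ measurable_sin m2.
have mS := @measurable_strip R a1 a2.
have q0 (F : borelC R -> R) z : (0 <= (F z ^+ 2)%:E)%E by rewrite lee_fin sqr_ge0.
apply: (@le_trans _ _ (\int[mu]_(z in strip a1 a2) (2%:E *
   ((c1 z ^+ 2)%:E + (s2 z ^+ 2)%:E + (c2 z ^+ 2)%:E + (s1 z ^+ 2)%:E)))%E).
  apply: ge0_le_integral => //.
  - apply: measurable_funTS; apply/measurable_EFinP; apply: measurable_funX.
    exact: measurable_normc (measurable_laplace mf).
  - apply: measurable_funeM; apply: emeasurable_funD => //.
    by apply: emeasurable_funD => //; exact: emeasurable_funD.
  - move=> z sz; have /andP[az _] : a1 <= complex.Re z <= a2 := sz.
    rewrite -!EFinD -EFinM lee_fin normc_sqr.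
    rewrite (Re_laplace mf integrable_damped az) (Im_laplace mf integrable_damped az).
    rewrite -/c1 -/c2 -/s1 -/s2; move: (c1 z) (c2 z) (s1 z) (s2 z) => u v w x.
    by have := sqr_ge0 (u - x); have := sqr_ge0 (v + w); nra.
rewrite ge0_integralZl_EFin//; last 2 first.
- by move=> z _; rewrite !adde_ge0.
- by apply: emeasurable_funD => //; apply: emeasurable_funD => //; exact: emeasurable_funD.
rewrite ge0_integralD//; last 2 first.
- by move=> z _; rewrite !adde_ge0.
- by apply: emeasurable_funD => //; exact: emeasurable_funD.
rewrite ge0_integralD//; last 2 first.
- by move=> z _; rewrite !adde_ge0.
- exact: emeasurable_funD.
rewrite ge0_integralD//.
apply: (@le_trans _ _ (2%:E * ((S * W)%:E + (S * W)%:E + (S * W)%:E + (S * W)%:E))%E).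
  apply: lee_wpmul2l => //.
  by apply: leeD S1; apply: leeD C2; exact: leeD C1 S2.
rewrite -!EFinD -EFinM lee_fin; lra.
Qed.

End l2.
End laplace.

(** * Power estimates on the strip *)

Section powers.
Variable R : realType.
Implicit Types (u c x y k p v th : R).

Lemma powR_le_anti c u y : 0 < c -> c <= u -> y <= 0 -> u `^ y <= c `^ y.
Proof.
move=> c0 cu y0; have u0 : 0 < u by exact: lt_le_trans cu.
rewrite -[y]opprK (powRN u (- y)) (powRN c (- y)) lef_pV2 ?posrE ?powR_gt0//.
by rewrite ge0_ler_powR ?nnegrE ?oppr_ge0// ltW.
Qed.

(** Compare [u] with [c]: for [u <= c] the first term is enough, for [u > c] the
    second.  Integrated against [e^(- a t)], this stands in for Hoelder's
    inequality. *)
Lemma powR_split c u k p : 0 < c -> 0 <= u -> 0 < k -> k <= p ->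
  u `^ k <= c `^ k + c `^ (k - p) * u `^ p.
Proof.
move=> c0 u0 k0 kp; have [uc|cu] := leP u c.
  rewrite (@le_trans _ _ (c `^ k))//.
    by rewrite ge0_ler_powR ?nnegrE// ltW.
  by rewrite lerDl mulr_ge0// powR_ge0.
rewrite (@le_trans _ _ (c `^ (k - p) * u `^ p))//; last first.
  by rewrite lerDr powR_ge0.
have u1 : 0 < u by exact: lt_trans cu.
rewrite (_ : u `^ k = u `^ (k - p) * u `^ p); last first.
  by rewrite -powRD ?subrK// (gt_eqF u1) implybT.
by rewrite ler_wpM2r ?powR_ge0// powR_le_anti ?(ltW cu)// subr_le0.
Qed.

(** The terms form a geometric progression whose largest admissible member is
    at most [v ^ th]. *)
Lemma truncated_geometric_sum_le x v th n : 0 <= x -> 0 <= v -> 0 < th ->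
  \sum_(0 <= j < n) (if x / 2 ^+ j <= v then (x / 2 ^+ j) `^ th else 0) <=
  (1 - 2 `^ (- th))^-1 * v `^ th.
Proof.
move=> x0 v0 th0.
pose e := (2 : R) `^ (- th).
have e0 : 0 < e by rewrite powR_gt0.
have e1 : e < 1.
  rewrite /e powRN invf_lt1 ?powR_gt0//.
  have := @gt0_ltr_powR R th th0 1 2; rewrite !nnegrE => /(_ ler01 (ler0n _ _)).
  by rewrite ltr1n powR1; exact.
have e1' : 0 < 1 - e by rewrite subr_gt0.
rewrite -/e; elim: n x x0 => [|n IH] x x0.
  by rewrite big_nil mulr_ge0 ?powR_ge0// invr_ge0 ltW.
have [xv|vx] := leP x v; last first.
  rewrite big_nat_recl//= expr0 divr1 (lt_geF vx) add0r.
  under eq_bigr do rewrite exprS invfM mulrA.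
  by apply: IH; rewrite divr_ge0.
have halfE (j : nat) : (x / 2 ^+ j) `^ th = x `^ th * e ^+ j.
  rewrite powRM ?invr_ge0 ?exprn_ge0//; congr (_ * _).
  have -> : (2 ^+ j)^-1 = (2 : R) `^ (- j%:R) by rewrite powR_invn.
  have -> : e ^+ j = e `^ j%:R by rewrite powR_mulrn// ltW.
  by rewrite /e -2!powRrM; congr (2 `^ _); rewrite !mulNr mulrC.
apply: (@le_trans _ _ (\sum_(0 <= j < n.+1) x `^ th * e ^+ j)).
  apply: ler_sum => j _; case: ifPn => _; first by rewrite halfE.
  by rewrite mulr_ge0 ?powR_ge0// exprn_ge0// ltW.
rewrite -mulr_sumr mulrC.
apply: ler_pM; rewrite ?powR_ge0 ?sumr_ge0//.
- by move=> j _; rewrite exprn_ge0// ltW.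
- have S m : \sum_(0 <= j < m) e ^+ j = (1 - e ^+ m) / (1 - e).
    elim: m => [|m IHm]; first by rewrite big_nil expr0 subrr mul0r.
    rewrite big_nat_recr//= IHm exprS; field.
    by rewrite gt_eqF.
  by rewrite S ler_pdivrMr// mulVf ?gt_eqF// gerBl exprn_ge0// (ltW e0).
- by rewrite ge0_ler_powR ?nnegrE// ltW.
Qed.

Lemma dyadic_level (A l : R) : 0 < l -> l <= A -> exists j : nat, A / 2 ^+ j.+1 < l <= A / 2 ^+ j.
Proof.
move=> l0 lA; have A0 : 0 < A by exact: lt_le_trans lA.
have ex : exists n, A / 2 ^+ n < l.
  exists (Num.bound (A / l)); rewrite ltr_pdivrMr ?exprn_gt0//.
  rewrite mulrC -ltr_pdivrMr//.
  have := archi_boundP (divr_ge0 (ltW A0) (ltW l0)); set b := Num.bound _.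
  move=> /lt_le_trans; apply; rewrite -natrX ler_nat ltnW// ltn_expl//.
have [[|n] An nmin] := ex_minnP ex.
  by move: An; rewrite expr0 divr1 ltNge lA.
exists n; rewrite An/= leNgt; apply/negP => /nmin.
by rewrite ltnn.
Qed.

End powers.

Section damped_powers.
Variable R : realType.
Notation leb := (@lebesgue_measure R).
Notation pos := (posreals R).
Variables (f : R -> R[i]) (p N a : R).
Hypothesis p1 : 1 < p.
Hypothesis N0 : 0 < N.
Hypothesis a0 : 0 < a.
Hypothesis mf : Defs.measurableC pos f.
Hypothesis fp : leb.-integrable pos (fun t => (normc (f t) `^ p)%:E).
Hypothesis fN : \int[leb]_(t in pos) (normc (f t) `^ p) <= N `^ p.

Lemma measurable_normc_powR y : measurable_fun pos (fun t => normc (f t) `^ y).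
Proof.
exact: (measurableT_comp (@measurable_powR R y) (measurable_normc mf)).
Qed.

(** [powR_split] with [c = N a^(1/p)], the value that balances the two terms. *)
Lemma integrable_damped_power k : 0 < k -> k <= p ->
  leb.-integrable pos (fun t => (normc (f t) `^ k * expR (- (a * t)))%:E) /\
  \int[leb]_(t in pos) (normc (f t) `^ k * expR (- (a * t))) <= 2 * (N `^ k * a `^ (k / p - 1)).
Proof.
move=> k0 kp.
pose c := N * a `^ p^-1.
have c0 : 0 < c by rewrite mulr_gt0// powR_gt0.
have p0 : 0 < p by exact: lt_trans p1.
pose G t := c `^ k * expR (- (a * t)) + c `^ (k - p) * normc (f t) `^ p.
have ie := integrable_expR a0.
have mp := @measurable_posreals R.
have i1 : leb.-integrable pos (fun t => (c `^ k * expR (- (a * t)))%:E).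
  exact: RintegrableZl.
have i2 : leb.-integrable pos (fun t => (c `^ (k - p) * normc (f t) `^ p)%:E).
  exact: RintegrableZl.
have iG : leb.-integrable pos (fun t => (G t)%:E) by exact: RintegrableD.
have leG t : pos t -> normc (f t) `^ k * expR (- (a * t)) <= G t.
  move=> t0; have e1 : expR (- (a * t)) <= 1.
    move: t0; rewrite /posreals/= in_itv/= andbT => t0.
    by rewrite -expR0 ler_expR oppr_le0 mulr_ge0 ?ltW.
  apply: (@le_trans _ _ ((c `^ k + c `^ (k - p) * normc (f t) `^ p) * expR (- (a * t)))).
    by rewrite ler_wpM2r ?expR_ge0// powR_split// normc_ge0.
  rewrite mulrDl lerD2l ler_piMr// mulr_ge0 ?powR_ge0//.
have iK : leb.-integrable pos (fun t => (normc (f t) `^ k * expR (- (a * t)))%:E).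
  apply: (@Rintegrable_le _ _ _ leb pos _ G) => //.
    apply: measurable_funM; [exact: measurable_normc_powR|exact: measurable_expRM].
  by move=> t t0; rewrite ger0_norm; [exact: leG|rewrite mulr_ge0 ?powR_ge0 ?expR_ge0].
split => //.
(* The two terms of [G] both integrate to at most [N^k a^(k/p - 1)]. *)
apply: (@le_trans _ _ (\int[leb]_(t in pos) G t)); first exact: le_Rintegral.
rewrite /G RintegralD// !RintegralZl//.
have -> : \int[leb]_(t in pos) expR (- (a * t)) = a^-1.
  by rewrite /Rintegral integral_expR.
rewrite mulr_natl mulr2n lerD//.
  rewrite /c powRM ?powR_ge0 ?(ltW N0)// -mulrA -powRrM.
  rewrite powRB ?(gt_eqF a0) ?implybT// powRr1 ?(ltW a0)//.
  by rewrite [p^-1 * k]mulrC.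
apply: (@le_trans _ _ (c `^ (k - p) * N `^ p)).
  by rewrite ler_wpM2l ?powR_ge0.
rewrite /c powRM ?powR_ge0 ?(ltW N0)// -powRrM mulrAC -powRD ?subrK; last first.
  by rewrite (gt_eqF N0) implybT.
by rewrite mulrBr mulVf ?gt_eqF// [p^-1 * k]mulrC.
Qed.

Lemma integrable_damped1 :
  leb.-integrable pos (fun t => (normc (f t) * expR (- (a * t)))%:E).
Proof.
have [h _] := integrable_damped_power ltr01 (ltW p1).
by under eq_fun do rewrite -[normc _]powRr1 ?normc_ge0//.
Qed.

Lemma laplace_sup z : a <= complex.Re z ->
  normc (laplace f z) <= 4 * (N * a `^ (p^-1 - 1)).
Proof.
move=> az; rewrite (le_trans (normc_laplace_le mf integrable_damped1 az))//.
have [_] := integrable_damped_power ltr01 (ltW p1).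
under eq_Rintegral do rewrite powRr1 ?normc_ge0//.
by rewrite powRr1 ?(ltW N0)// div1r; lra.
Qed.

End damped_powers.

(** * From square-integrable functions to exponent p *)

(** An [L^s] bound and a sup bound give an [L^q] bound. *)
Lemma powR_le_interp (R : realType) (u A s q : R) : 0 <= u -> u <= A -> 0 < s -> s <= q ->
  u `^ q <= A `^ (q - s) * u `^ s.
Proof.
move=> u0 uA s0 sq; have q0 : 0 < q by exact: lt_le_trans sq.
move: u0; rewrite le_eqVlt => /predU1P[<-|u0].
  by rewrite powR0 ?gt_eqF// mulr_ge0 ?powR_ge0.
have -> : u `^ q = u `^ (q - s) * u `^ s.
  by rewrite -powRD ?subrK// (gt_eqF u0) implybT.
by rewrite ler_wpM2r ?powR_ge0// ge0_ler_powR ?nnegrE ?subr_ge0// ?(ltW u0)//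
  (le_trans (ltW u0)).
Qed.

Lemma measurableC_cut (R : realType) (c : R -> bool) (f : R -> R[i]) :
  measurable_fun (posreals R) c -> Defs.measurableC (posreals R) f ->
  Defs.measurableC (posreals R) (fun t => if c t then f t else 0).
Proof.
move=> mc [m1 m2].
have cut (F : R -> R) : measurable_fun (posreals R) F ->
    measurable_fun (posreals R) (fun t => if c t then F t else 0).
  move=> mF; apply: measurable_fun_if; [exact: measurable_posreals|exact: mc| |exact: measurable_cst].
  exact: measurable_funS (@measurable_posreals R) (@subIsetl _ _ _) mF.
split.
- rewrite (_ : (fun x => _) = fun t => if c t then complex.Re (f t) else 0).
    exact: cut.
  by apply/funext => t; case: ifP.
- rewrite (_ : (fun x => _) = fun t => if c t then complex.Im (f t) else 0).
    exact: cut.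
  by apply/funext => t; case: ifP.
Qed.

Lemma quarter_le_of_split (R : realFieldType) (l x y z : R) :
  l / 2 < x -> x <= y + z -> z <= l / 4 -> l / 4 <= y.
Proof. lra. Qed.

Section upper.
Variable R : realType.
Notation leb := (@lebesgue_measure R).
Notation pos := (posreals R).
Variables (mu : {measure set (borelC R) -> \bar R}) (a1 a2 C r : R).
Hypothesis a1_gt0 : 0 < a1.
Hypothesis a12 : a1 <= a2.
Hypothesis C0 : 0 < C.
Hypothesis carleson : carleson_condition mu r C.
Let S := schur_const a1 a2 C r.
Variables (f : R -> R[i]) (p N : R).
Hypothesis p1 : 1 < p.
Hypothesis N0 : 0 < N.
Hypothesis mf : Defs.measurableC pos f.
Hypothesis fp : leb.-integrable pos (fun t => (normc (f t) `^ p)%:E).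
Hypothesis fN : \int[leb]_(t in pos) (normc (f t) `^ p) <= N `^ p.
Let A := 4 * (N * a1 `^ (p^-1 - 1)).

Let A0 : 0 < A. Proof. by rewrite !mulr_gt0 ?powR_gt0. Qed.

Let S0 : 0 < S. Proof. exact: (schur_const_gt0 _ a1_gt0 a12 C0). Qed.

Let supA z : strip a1 a2 z -> normc (laplace f z) <= A.
Proof. by move=> /andP[az _]; exact: (laplace_sup p1 N0 a1_gt0 mf fp fN az). Qed.

Lemma measurable_laplace_powR (g : R -> R[i]) y D : Defs.measurableC pos g ->
  measurable_fun (D : set (borelC R)) (fun z => (normc (laplace g z) `^ y)%:E).
Proof.
move=> mg; apply: measurable_funTS; apply/measurable_EFinP.
exact: (measurableT_comp (@measurable_powR R y) (measurable_normc (measurable_laplace mg))).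
Qed.

Lemma laplace_raise_exponent s q c : 0 < s -> s <= q ->
  (\int[mu]_(z in strip a1 a2) (normc (laplace f z) `^ s)%:E <= c%:E)%E ->
  (\int[mu]_(z in strip a1 a2) (normc (laplace f z) `^ q)%:E <=
    (A `^ (q - s) * c)%:E)%E.
Proof.
move=> s0 sq sc.
apply: (@le_trans _ _ (\int[mu]_(z in strip a1 a2)
    ((A `^ (q - s))%:E * (normc (laplace f z) `^ s)%:E))%E).
  apply: ge0_le_integral.
  - exact: measurable_strip.
  - by move=> z _; rewrite lee_fin powR_ge0.
  - exact: measurable_laplace_powR.
  - by apply: measurable_funeM; exact: measurable_laplace_powR.
  - move=> z sz; rewrite -EFinM lee_fin.
    by rewrite powR_le_interp ?normc_ge0// supA.
rewrite ge0_integralZl_EFin ?powR_ge0//; last 3 first.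
- exact: measurable_strip.
- by move=> z _; rewrite lee_fin powR_ge0.
- exact: measurable_laplace_powR.
by rewrite EFinM lee_wpmul2l// lee_fin powR_ge0.
Qed.

(** For [p >= 2] the weighted [L^2] norm of [laplace_l2] is controlled by
    [integrable_damped_power] with exponent 2. *)
Lemma laplace_l2_ge2 : 2 <= p ->
  (\int[mu]_(z in strip a1 a2) (normc (laplace f z) `^ 2)%:E <=
    (16 * (S * (N `^ 2 * a1 `^ (2 / p - 1))))%:E)%E.
Proof.
move=> p2; have [i2 i2N] := integrable_damped_power p1 N0 a1_gt0 mf fp fN (ltr0Sn _ _) p2.
have sqE u : u >= 0 -> u `^ (2 : R) = u ^+ 2 by move=> u0; rewrite powR_mulrn.
have i2' : leb.-integrable pos (fun t => (normc (f t) ^+ 2 * expR (- (a1 * t)))%:E).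
  by under eq_fun do rewrite -sqE ?normc_ge0//.
under eq_integral do rewrite sqE ?normc_ge0//.
apply: le_trans (laplace_l2 a1_gt0 a12 C0 carleson mf i2') _.
rewrite lee_fin.
under eq_Rintegral do rewrite -sqE ?normc_ge0//.
apply: le_trans (ler_wpM2l _ i2N) _; first by rewrite mulr_ge0// ltW.
by rewrite -/S; lra.
Qed.

Section marcinkiewicz.
Variable p' : R.
Hypothesis p2 : p < 2.
Hypothesis pp' : p^-1 + p'^-1 = 1.
Hypothesis p'1 : 1 < p'.

Let th := p' - 2.
(* The cut [lam j |f|^(p - 1) = v]: above it, [|f| <= (lam j / v) |f|^p],
   so that [v = 8 N^p] makes the integral of the large part at most [lam j / 8]. *)
Let v := 8 * N `^ p.
Let lam (j : nat) := A / 2 ^+ j.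
Let small j t := lam j * normc (f t) `^ (p - 1) <= v.
Let g j t : R[i] := if small j t then f t else 0.
Let large j t := v < lam j * normc (f t) `^ (p - 1).
Let b j t : R[i] := if large j t then f t else 0.

Let p0 : 0 < p. Proof. exact: lt_trans p1. Qed.
Let p'0 : 0 < p'. Proof. exact: lt_trans p'1. Qed.

Let mulpp' : p * p' = p + p'.
Proof.
have := congr1 (fun x => x * (p * p')) pp'; rewrite mul1r => <-.
by field; rewrite !gt_eqF.
Qed.

Let th0 : 0 < th.
Proof.
rewrite /th; have := mulpp'.
suff : 0 < (p - 1) * (p' - 2).
  by rewrite pmulr_rgt0// subr_gt0.
have -> : (p - 1) * (p' - 2) = p * p' - p' - 2 * p + 2 by ring.
rewrite mulpp'; move: p2; lra.
Qed.

Let lam0 j : 0 < lam j. Proof. by rewrite divr_gt0// exprn_gt0. Qed.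
Let v0 : 0 < v. Proof. by rewrite mulr_gt0// powR_gt0. Qed.

Let msmall j : measurable_fun pos (small j).
Proof.
apply: measurable_fun_ler => //; apply: measurable_funM => //.
exact: measurable_normc_powR.
Qed.

Let mlarge j : measurable_fun pos (large j).
Proof.
apply: measurable_fun_ltr => //; apply: measurable_funM => //.
exact: measurable_normc_powR.
Qed.

Let mg j : Defs.measurableC pos (g j). Proof. exact: measurableC_cut. Qed.

Let mb j : Defs.measurableC pos (b j). Proof. exact: measurableC_cut. Qed.

Let exp_le1 t : pos t -> expR (- (a1 * t)) <= 1.
Proof.
rewrite /posreals/= in_itv/= andbT => t0.
by rewrite -expR0 ler_expR oppr_le0 mulr_ge0 ?ltW.
Qed.

Let b_le j t : pos t ->
  normc (b j t) * expR (- (a1 * t)) <= lam j / v * normc (f t) `^ p.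
Proof.
move=> t0; rewrite (@le_trans _ _ (normc (b j t)))//.
  by rewrite ler_piMr ?exp_le1 ?normc_ge0.
rewrite /b /large; case: ifPn => [h|_]; last first.
  by rewrite normc0 mulr_ge0 ?powR_ge0// divr_ge0 ?ltW.
have f0 : 0 < normc (f t).
  rewrite lt_neqAle normc_ge0 andbT; apply/eqP => f0.
  by move: h; rewrite -f0 powR0 ?mulr0 ?gt_eqF ?subr_gt0// => /lt_trans/(_ v0); rewrite ltxx.
have -> : normc (f t) `^ p = normc (f t) `^ (p - 1) * normc (f t) `^ 1.
  by rewrite -powRD ?subrK// (gt_eqF f0) implybT.
rewrite powRr1 ?normc_ge0//.
rewrite mulrA ler_peMl ?normc_ge0// mulrAC ler_pdivlMr// mul1r.
exact: ltW.
Qed.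

Let b_int j : leb.-integrable pos (fun t => (normc (b j t) * expR (- (a1 * t)))%:E).
Proof.
apply: (@Rintegrable_le _ _ _ leb pos _ (fun t => lam j / v * normc (f t) `^ p)).
- exact: measurable_posreals.
- by apply: measurable_funM; [exact: measurable_normc (mb j)|exact: measurable_expRM].
- move=> t t0; rewrite ger0_norm; first exact: b_le.
  by rewrite mulr_ge0 ?normc_ge0 ?expR_ge0.
- by apply: RintegrableZl => //; exact: measurable_posreals.
Qed.

Let laplace_b j z : a1 <= complex.Re z -> normc (laplace (b j) z) <= lam j / 4.
Proof.
move=> az; apply: le_trans (normc_laplace_le (mb j) (b_int j) az) _.
suff : \int[leb]_(t in pos) (normc (b j t) * expR (- (a1 * t))) <= lam j / 8 by lra.
apply: (@le_trans _ _ (\int[leb]_(t in pos) (lam j / v * normc (f t) `^ p))).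
  apply: le_Rintegral; [exact: measurable_posreals|exact: b_int| |exact: b_le].
  by apply: RintegrableZl => //; exact: measurable_posreals.
rewrite RintegralZl//; last exact: measurable_posreals.
apply: le_trans (ler_wpM2l _ fN) _; first by rewrite divr_ge0 ?ltW.
rewrite /v -mulrA ler_wpM2l ?(ltW (lam0 _))// invfM -mulrA mulVf ?mulr1//.
by rewrite gt_eqF// powR_gt0.
Qed.

Let fgb j t : f t = g j t + b j t.
Proof. by rewrite /g /b /small /large; case: leP => _; rewrite ?addr0 ?add0r. Qed.

Let normc_g j t : normc (g j t) <= normc (f t).
Proof. by rewrite /g; case: ifP => // _; rewrite normc0 normc_ge0. Qed.

Let f_damped := integrable_damped1 p1 N0 a1_gt0 mf fp fN.

Let g_int j : leb.-integrable pos (fun t => (normc (g j t) * expR (- (a1 * t)))%:E).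
Proof.
apply: (@Rintegrable_le _ _ _ leb pos _ (fun t => normc (f t) * expR (- (a1 * t)))) => //.
- exact: measurable_posreals.
- by apply: measurable_funM; [exact: measurable_normc (mg j)|exact: measurable_expRM].
- move=> t t0; rewrite ger0_norm; first by rewrite ler_wpM2r ?expR_ge0.
  by rewrite mulr_ge0 ?normc_ge0 ?expR_ge0.
Qed.

(* The exponents match because [p + (p - 1) (p' - 2) = 2]. *)
Let g_sqr j t : lam j `^ th * normc (g j t) ^+ 2 =
  normc (f t) `^ p * (if small j t then (lam j * normc (f t) `^ (p - 1)) `^ th else 0).
Proof.
rewrite /g; case: ifP => _; last by rewrite normc0 expr0n/= !mulr0.
rewrite powRM ?powR_ge0 ?(ltW (lam0 _))// [RHS]mulrCA; congr (_ `^ _ * _).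
have := normc_ge0 (f t); rewrite le_eqVlt => /predU1P[<-|f0].
  by rewrite powR0 ?gt_eqF// mul0r expr0n.
rewrite -powRrM -powRD; last by rewrite (gt_eqF f0) implybT.
rewrite -powR_mulrn ?(ltW f0)//; congr (_ `^ _).
have -> : p + (p - 1) * th = p * p' - p - p' + 2 by rewrite /th; ring.
by rewrite mulpp'; ring.
Qed.

Let K := (1 - 2 `^ (- th))^-1 * v `^ th.

Let g_sum t n : \sum_(0 <= j < n) (lam j `^ th * normc (g j t) ^+ 2) <=
  K * normc (f t) `^ p.
Proof.
under eq_bigr do rewrite g_sqr.
rewrite -mulr_sumr mulrC ler_wpM2r ?powR_ge0//.
have := @truncated_geometric_sum_le _ (A * normc (f t) `^ (p - 1)) v th n.
rewrite mulr_ge0 ?powR_ge0 ?(ltW A0)// (ltW v0) th0 => /(_ isT isT isT).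
apply: le_trans; apply: ler_sum => j _.
by rewrite /small /lam mulrAC.
Qed.

Let g2_le j t : pos t -> normc (g j t) ^+ 2 * expR (- (a1 * t)) <=
  K / lam j `^ th * normc (f t) `^ p.
Proof.
move=> t0; rewrite (@le_trans _ _ (normc (g j t) ^+ 2))//.
  by rewrite ler_piMr ?exp_le1 ?sqr_ge0.
rewrite mulrAC ler_pdivlMr ?powR_gt0// mulrC.
have := g_sum t j.+1; rewrite big_nat_recr//=; apply: le_trans.
by rewrite lerDr sumr_ge0// => i _; rewrite mulr_ge0 ?powR_ge0 ?sqr_ge0.
Qed.

Let g2_int j : leb.-integrable pos (fun t => (normc (g j t) ^+ 2 * expR (- (a1 * t)))%:E).
Proof.
apply: (@Rintegrable_le _ _ _ leb pos _ (fun t => K / lam j `^ th * normc (f t) `^ p)).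
- exact: measurable_posreals.
- apply: measurable_funM; last exact: measurable_expRM.
  by apply: measurable_funX; exact: measurable_normc (mg j).
- move=> t t0; rewrite ger0_norm; first exact: g2_le.
  by rewrite mulr_ge0 ?sqr_ge0 ?expR_ge0.
- by apply: RintegrableZl => //; exact: measurable_posreals.
Qed.

Let W j := \int[leb]_(t in pos) (normc (g j t) ^+ 2 * expR (- (a1 * t))).

Let W_sum n : \sum_(0 <= j < n) (lam j `^ th * W j) <= K * N `^ p.
Proof.
have mp := @measurable_posreals R.
have iW j : leb.-integrable pos
    (fun t => (lam j `^ th * (normc (g j t) ^+ 2 * expR (- (a1 * t))))%:E).
  exact: RintegrableZl.
have sumE m : leb.-integrable pos (fun t => (\sum_(0 <= j < m)
       (lam j `^ th * (normc (g j t) ^+ 2 * expR (- (a1 * t)))))%:E) /\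
    \sum_(0 <= j < m) (lam j `^ th * W j) = \int[leb]_(t in pos)
       \sum_(0 <= j < m) (lam j `^ th * (normc (g j t) ^+ 2 * expR (- (a1 * t)))).
  elim: m => [|m [im IH]].
    split; last first.
      rewrite big_nil (_ : (fun t => _) = cst 0) ?Rintegral_cst ?mul0r//.
      by apply/funext => t; rewrite big_nil.
    by under eq_fun do rewrite big_nil; exact: integrable0.
  split; first by under eq_fun do rewrite big_nat_recr//=; exact: RintegrableD.
  rewrite big_nat_recr//= IH /W.
  rewrite -(@RintegralZl _ _ R leb pos _ _ mp (g2_int m)).
  rewrite -(@RintegralD _ _ R leb pos _ _ mp im (iW m)).
  by apply: eq_Rintegral => t _; rewrite big_nat_recr.
have [isum ->] := sumE n.
have iK : leb.-integrable pos (fun t => (K * normc (f t) `^ p)%:E) by exact: RintegrableZl.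
have K0 : 0 <= K.
  rewrite mulr_ge0 ?powR_ge0// invr_ge0 subr_ge0 powRN invf_le1 ?powR_gt0//.
  have := @ge0_ler_powR R th (ltW th0) 1 2; rewrite !nnegrE powR1 => /(_ ler01 (ler0n _ _)).
  by apply; rewrite ler1n.
apply: (@le_trans _ _ (\int[leb]_(t in pos) (K * normc (f t) `^ p))); last first.
  by rewrite RintegralZl// ler_wpM2l.
apply: le_Rintegral => // t t0; apply: le_trans (g_sum t n).
apply: ler_sum => j _; rewrite ler_wpM2l ?powR_ge0// ler_piMr ?exp_le1 ?sqr_ge0//.
Qed.

Let laplace_pow_le_series z : strip a1 a2 z ->
  ((normc (laplace f z) `^ p')%:E <=
   \sum_(0 <= j <oo) ((16 * lam j `^ th)%:E * (normc (laplace (g j) z) ^+ 2)%:E))%E.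
Proof.
move=> sz; have az : a1 <= complex.Re z by case/andP: sz.
pose T j := ((16 * lam j `^ th)%:E * (normc (laplace (g j) z) ^+ 2)%:E)%E.
have T0 j : (0 <= T j)%E.
  by rewrite /T -EFinM lee_fin mulr_ge0 ?sqr_ge0// mulr_ge0 ?powR_ge0.
have [l0|l0] := eqVneq (normc (laplace f z)) 0.
  rewrite l0 powR0 ?gt_eqF//; apply: nneseries_ge0 => j _ _; exact: T0.
have lpos : 0 < normc (laplace f z) by rewrite lt_neqAle eq_sym l0 normc_ge0.
(* A single term of the series, at the dyadic level of [|L f z|], suffices. *)
have [j /andP[jl lj]] := dyadic_level lpos (supA sz).
have := @nneseries_lim_ge R T xpredT 0 j.+1 (fun n _ _ => T0 n).
apply: le_trans; rewrite big_nat_recr//=.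
apply: (@le_trans _ _ (T j)); last by rewrite leeDr// sume_ge0.
rewrite /T -EFinM lee_fin.
have tri := laplace_triangle (fgb j) (integrable_laplace_integrand (mg j) (g_int j) az)
  (integrable_laplace_integrand (mb j) (b_int j) az).
have lb := laplace_b j az.
have lg : lam j / 4 <= normc (laplace (g j) z).
  apply: quarter_le_of_split tri lb.
  by move: jl; rewrite exprS invfM mulrCA mulrC.
have -> : normc (laplace f z) `^ p' = normc (laplace f z) `^ th * normc (laplace f z) ^+ 2.
  rewrite -powR_mulrn ?normc_ge0// -powRD ?subrK//.
  by rewrite gt_eqF ?implybT.
apply: (@le_trans _ _ (lam j `^ th * lam j ^+ 2)).
  rewrite ler_pM ?powR_ge0 ?sqr_ge0//.
    by rewrite ge0_ler_powR ?nnegrE ?normc_ge0 ?(ltW th0) ?(ltW (lam0 _)).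
  by rewrite ler_pXn2r ?nnegrE ?normc_ge0 ?(ltW (lam0 _)).
rewrite [leRHS]mulrAC [leRHS]mulrC; apply: ler_wpM2l; first exact: powR_ge0.
have : (lam j / 4) ^+ 2 <= normc (laplace (g j) z) ^+ 2.
  have l4 : 0 <= lam j / 4 by apply: divr_ge0 => //; exact: ltW (lam0 j).
  by rewrite ler_pXn2r ?nnegrE ?normc_ge0 ?l4.
by rewrite exprMn exprVn ler_pdivrMr ?exprn_gt0// mulrC -natrX.
Qed.

(** At each dyadic level [lam j] of [|L f|], split [f = g j + b j] according
    to the size of [|f|].  The transform of the large part [b j] is at most
    [lam j / 4], so on [lam j / 2 < |L f| <= lam j] that of the small part [g j]
    is at least [lam j / 4], and its square integral is bounded by
    [laplace_l2].  Summed over the levels, a geometric series reconstitutes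
    [|f|^p]. *)
Lemma laplace_marcinkiewicz :
  (\int[mu]_(z in strip a1 a2) (normc (laplace f z) `^ p')%:E <=
    (128 * (S * ((1 - 2 `^ (- (p' - 2)))^-1 * (8 * N `^ p) `^ (p' - 2) * N `^ p)))%:E)%E.
Proof.
have mS := @measurable_strip R a1 a2.
have m2 j (D : set (borelC R)) : measurable_fun D (fun z => (normc (laplace (g j) z) ^+ 2)%:E).
  apply: measurable_funTS; apply/measurable_EFinP; apply: measurable_funX.
  exact: measurable_normc (measurable_laplace (mg j)).
have c0 j : 0 <= 16 * lam j `^ th by rewrite mulr_ge0 ?powR_ge0.
have T0 j z : (0 <= (16 * lam j `^ th)%:E * (normc (laplace (g j) z) ^+ 2)%:E)%E.
  by rewrite -EFinM lee_fin mulr_ge0 ?sqr_ge0.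
have mT j : measurable_fun (strip a1 a2 : set (borelC R))
    (fun z => (16 * lam j `^ th)%:E * (normc (laplace (g j) z) ^+ 2)%:E)%E.
  exact: measurable_funeM.
apply: (@le_trans _ _ (\int[mu]_(z in strip a1 a2)
  \sum_(0 <= j <oo) ((16 * lam j `^ th)%:E * (normc (laplace (g j) z) ^+ 2)%:E))%E).
  apply: ge0_le_integral => //.
  - by move=> z _; rewrite lee_fin powR_ge0.
  - exact: measurable_laplace_powR.
  - by apply: ge0_emeasurable_sum => // j z _ _; exact: T0.
rewrite integral_nneseries//.
apply: lime_le.
  by apply: is_cvg_nneseries => j _ _; exact: integral_ge0.
apply: nearW => n.
apply: (@le_trans _ _ (\sum_(0 <= j < n) (128 * S * (lam j `^ th * W j))%:E)%E).
  apply: lee_sum => j _.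
  rewrite ge0_integralZl_EFin//; last by move=> z _; rewrite lee_fin sqr_ge0.
  apply: le_trans (lee_wpmul2l _ (laplace_l2 a1_gt0 a12 C0 carleson (mg j) (g2_int j))) _.
    by rewrite lee_fin.
  rewrite -EFinM lee_fin -/S -/(W j); lra.
rewrite sumEFin lee_fin -mulr_sumr [leRHS]mulrA.
by apply: ler_wpM2l (W_sum n); rewrite mulr_ge0// ltW.
Qed.

End marcinkiewicz.
End upper.

(** * Scaling: only the ratio of the abscissas survives *)

Section scaling.
Variable R : realType.
Variables (p p' q a1 a2 N : R).
Hypothesis p1 : 1 < p.
Hypothesis p'1 : 1 < p'.
Hypothesis pp' : p^-1 + p'^-1 = 1.
Hypothesis a1_gt0 : 0 < a1.
Hypothesis a2_gt0 : 0 < a2.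
Hypothesis N0 : 0 < N.

Let p0 : p != 0. Proof. by rewrite gt_eqF// (lt_trans _ p1). Qed.
Let p'0 : p' != 0. Proof. by rewrite gt_eqF// (lt_trans _ p'1). Qed.

(** Taking logarithms turns the identity into two linear ones between
    exponents: [e1] and [e2] are the powers of [N] and [a1] contributed by the
    bound on the [L^s] norm. *)
Lemma scaling_exponents (s e1 e2 : R) :
  (q - s) + e1 = q -> (p^-1 - 1) * (q - s) - 2 + e2 = - (q / p' + 1) ->
  N `^ (q - s) * a1 `^ ((p^-1 - 1) * (q - s)) *
  (a2 `^ (q / p') * (a2 / a1 ^+ 2)) * (N `^ e1 * a1 `^ e2) =
  (a2 / a1) `^ (q / p' + 1) * N `^ q.
Proof.
move=> h1 h2.
rewrite -(lnK (x := N)) ?posrE// -(lnK (x := a1)) ?posrE// -(lnK (x := a2)) ?posrE//.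
move: (ln N) (ln a1) (ln a2) => n al be.
rewrite -expRN -expRD -!expRM expr2 -!expRD -expRN -!expRD.
congr expR.
have -> : (be - al) * (q / p' + 1) + n * q =
  be * (q / p' + 1) + al * (- (q / p' + 1)) + n * q by ring.
rewrite -[in n * q]h1 -h2; ring.
Qed.

End scaling.

Section strip_bound.
Variable R : realType.
Variables (p p' q : R).
Hypothesis p1 : 1 < p.
Hypothesis pp' : p^-1 + p'^-1 = 1.
Hypothesis p'1 : 1 < p'.
Hypothesis p'q : p' <= q.
Hypothesis q2 : 2 <= q.
Notation leb := (@lebesgue_measure R).
Notation pos := (posreals R).

Let p0 : p != 0. Proof. by rewrite gt_eqF// (lt_trans _ p1). Qed.
Let p'0 : p' != 0. Proof. by rewrite gt_eqF// (lt_trans _ p'1). Qed.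
Let pE : p^-1 = 1 - p'^-1. Proof. by rewrite -pp' addrK. Qed.

Let mulpp' : p * p' = p + p'.
Proof.
have := congr1 (fun x => x * (p * p')) pp'; rewrite mul1r => <-.
by field; rewrite p0 p'0.
Qed.

(** Both cases [2 <= p] and [p < 2] end with the same powers of [a1], [a2], [N]. *)
Lemma laplace_strip_bound : exists2 D : R, 0 <= D &
  forall (mu : {measure set (borelC R) -> \bar R}) (a1 a2 C : R) (f : R -> R[i]) (N : R),
  0 < a1 -> a1 <= a2 -> 0 < C -> carleson_condition mu (q / p') C ->
  0 < N -> Defs.measurableC pos f ->
  leb.-integrable pos (fun t => (normc (f t) `^ p)%:E) ->
  \int[leb]_(t in pos) (normc (f t) `^ p) <= N `^ p ->
  (\int[mu]_(z in strip a1 a2) (normc (laplace f z) `^ q)%:E <=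
   (D * (C * (a2 / a1) `^ (q / p' + 1)) * N `^ q)%:E)%E.
Proof.
have [p2|p2] := leP 2 p.
- exists (4 `^ (q - 2) * 16 * 12 * 2 `^ (q / p')).
    by rewrite !mulr_ge0 ?powR_ge0.
  move=> mu a1 a2 C f N a10 a12 C0 carleson N0 mf fp fN.
  have a20 : 0 < a2 by exact: lt_le_trans a12.
  have h := laplace_l2_ge2 a10 a12 C0 carleson p1 N0 mf fp fN p2.
  have s0 : (0 : R) < 2 by [].
  apply: le_trans (laplace_raise_exponent a10 p1 N0 mf fp fN s0 q2 h) _.
  rewrite lee_fin le_eqVlt; apply/orP; left; apply/eqP.
  set t := (a2 / a1) `^ _; rewrite /schur_const !powRM ?powR_ge0 ?mulr_ge0 ?powR_ge0 ?(ltW N0) ?(ltW a20)//.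
  have E : (q - 2) + 2 = q by rewrite subrK.
  have E' : (p^-1 - 1) * (q - 2) - 2 + (2 / p - 1) = - (q / p' + 1).
    by rewrite pE; field.
  have := scaling_exponents a10 a20 N0 E E'.
  rewrite -!powRrM.
  set u := N `^ (q - 2); set v := a1 `^ _; set w := a2 `^ (q / p'); set x := a2 / a1 ^+ 2.
  set y := N `^ 2; set s := a1 `^ (2 / p - 1); rewrite -/t; set o := N `^ q.
  move=> EE; transitivity (4 `^ (q - 2) * 16 * 12 * 2 `^ (q / p') * C *
    (u * v * (w * x) * (y * s))).
    by ring.
  by rewrite EE; ring.
- exists (4 `^ (q - p') * 128 * 12 * 2 `^ (q / p') * ((1 - 2 `^ (- (p' - 2)))^-1 * 8 `^ (p' - 2))).
    have th0 : 0 <= p' - 2.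
      have p10 : 0 < p - 1 by rewrite subr_gt0.
      rewrite -(pmulr_rge0 _ p10).
      have -> : (p - 1) * (p' - 2) = p * p' - p' - 2 * p + 2 by ring.
      by rewrite mulpp'; move: p2; lra.
    rewrite !mulr_ge0 ?powR_ge0// invr_ge0 subr_ge0 powRN invf_le1 ?powR_gt0//.
    have := @ge0_ler_powR R (p' - 2) th0 1 2; rewrite !nnegrE powR1 => /(_ ler01 (ler0n _ _)).
    by apply; rewrite ler1n.
  move=> mu a1 a2 C f N a10 a12 C0 carleson N0 mf fp fN.
  have a20 : 0 < a2 by exact: lt_le_trans a12.
  have h := laplace_marcinkiewicz a10 a12 C0 carleson p1 N0 mf fp fN p2 pp' p'1.
  have s0 : 0 < p' by exact: lt_trans p'1.
  apply: le_trans (laplace_raise_exponent a10 p1 N0 mf fp fN s0 p'q h) _.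
  rewrite lee_fin le_eqVlt; apply/orP; left; apply/eqP.
  set t := (a2 / a1) `^ _; rewrite /schur_const !powRM ?powR_ge0 ?mulr_ge0 ?powR_ge0 ?(ltW N0) ?(ltW a20)//.
  have E : (q - p') + (p * (p' - 2) + p) = q.
    have -> : (q - p') + (p * (p' - 2) + p) = q - p' + (p * p' - p) by ring.
    by rewrite mulpp'; ring.
  have E' : (p^-1 - 1) * (q - p') - 2 + 0 = - (q / p' + 1).
    by rewrite pE; field.
  have := scaling_exponents a10 a20 N0 E E'.
  rewrite -!powRrM powRr0 mulr1 [N `^ (_ + p)]powRD; last by rewrite (gt_eqF N0) implybT.
  set u := N `^ (q - p'); set v := a1 `^ _; set w := a2 `^ (q / p'); set x := a2 / a1 ^+ 2.
  set y := N `^ (p * (p' - 2)); set s := N `^ p; rewrite -/t; set o := N `^ q.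
  set c := (1 - _)^-1.
  move=> EE; transitivity (4 `^ (q - p') * 128 * 12 * 2 `^ (q / p') *
    (c * 8 `^ (p' - 2)) * C * (u * v * (w * x) * (y * s))).
    by ring.
  by rewrite EE; ring.
Qed.

End strip_bound.

(** * The embedding, the exponentials, and the covering argument *)

Section LnormC_facts.
Context d (T : measurableType d) (R : realType).
Variables (m : {measure set T -> \bar R}) (D : set T) (g : T -> R[i]).

Lemma poweR_LnormC p : p != 0 ->
  (LnormC m D p g `^ p)%E = (\int[m]_(x in D) (normc (g x) `^ p)%:E)%E.
Proof.
move=> p0; rewrite /LnormC poweR_Lnorm// [RHS]integral_mkcond.
apply: eq_integral => x _; rewrite !patchE; case: ifP => _.
  by rewrite /= ger0_norm ?normc_ge0.
by rewrite /= normr0 powR0.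
Qed.

Lemma LnormC_ge0 p : (0 <= LnormC m D p g)%E.
Proof. exact: Lnorm_ge0. Qed.

Lemma LnormC_le p c : 0 < p -> 0 <= c ->
  (\int[m]_(x in D) (normc (g x) `^ p)%:E <= (c `^ p)%:E)%E -> (LnormC m D p g <= c%:E)%E.
Proof.
move=> p0 c0; rewrite -poweR_LnormC ?gt_eqF// => h.
have pV : 0 <= p^-1 by rewrite invr_ge0 ltW.
have := @gt0_ler_poweR R p^-1 pV (LnormC m D p g `^ p)%E (c `^ p)%:E.
rewrite !in_itv/= !leey !andbT !poweR_ge0 lee_fin powR_ge0 => /(_ isT isT h).
rewrite -poweRrM mulfV ?gt_eqF// poweRe1 ?LnormC_ge0// -powRrM mulfV ?gt_eqF//.
by rewrite powRr1.
Qed.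

Lemma LnormC_ge p c : 0 < p -> 0 <= c ->
  (LnormC m D p g <= c%:E)%E -> (\int[m]_(x in D) (normc (g x) `^ p)%:E <= (c `^ p)%:E)%E.
Proof.
move=> p0 c0 h; rewrite -poweR_LnormC ?gt_eqF//.
have := @gt0_ler_poweR R p (ltW p0) (LnormC m D p g) c%:E.
by rewrite !in_itv/= !leey !andbT lee_fin LnormC_ge0 c0 => /(_ isT isT h).
Qed.

End LnormC_facts.

Section supported.
Variable R : realType.
Variables (mu : {measure set (borelC R) -> \bar R}) (a1 a2 : R).
Hypothesis a1_gt0 : 0 < a1.
Hypothesis mu0 : supported_in mu (strip a1 a2).

Lemma strip_Cplus : strip a1 a2 `<=` Cplus R.
Proof. by move=> z /andP[az _]; exact: lt_le_trans az. Qed.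

Lemma measurable_Cplus : measurable (Cplus R : set (borelC R)).
Proof.
rewrite (_ : Cplus R = @complex.Re R @^-1` `]0, +oo[).
  rewrite -[X in measurable X]setTI.
  exact: (@measurable_Re R) measurableT _ (measurable_itv _).
by apply/seteqP; split => z /=; rewrite /Cplus/= in_itv/= andbT.
Qed.

(** The complement of the strip is a null set. *)
Lemma integral_Cplus (F : borelC R -> R) : measurable_fun setT F -> (forall z, 0 <= F z) ->
  (\int[mu]_(z in Cplus R) (F z)%:E = \int[mu]_(z in strip a1 a2) (F z)%:E)%E.
Proof.
move=> mF F0.
have mN : measurable (~` strip a1 a2 : set (borelC R)).
  by apply: measurableC; exact: measurable_strip.
rewrite (@ge0_negligible_integral _ _ _ mu (Cplus R) (~` strip a1 a2))//.
- by rewrite setDE setCK setIidr//; exact: strip_Cplus.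
- exact: measurable_Cplus.
- by apply: measurable_funTS; exact/measurable_EFinP.
- by move=> z _; rewrite lee_fin.
Qed.

End supported.

Section upper_bound.
Variable R : realType.
Notation leb := (@lebesgue_measure R).
Notation pos := (posreals R).

(** [laplace_strip_bound] holds for every [N] above the norm of [f]; letting
    [N] decrease to the norm also covers the case of norm zero. *)
Lemma carleson_to_laplace (p p' q : R) : 1 < p -> p^-1 + p'^-1 = 1 ->
    1 < p' -> p' <= q -> 2 <= q ->
  exists B : R -> R -> R,
  forall (mu : {measure set (borelC R) -> \bar R}) (a1 a2 : R),
    0 < a1 -> a1 <= a2 -> supported_in mu (strip a1 a2) ->
    forall C : R, 0 < C -> carleson_condition mu (q / p') C ->
       laplace_bounded_by mu p q (B C (a2 / a1)).
Proof.
move=> p1 pp' p'1 p'q q2.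
have [D D0 hD] := laplace_strip_bound p1 pp' p'1 p'q q2.
have p0 : 0 < p by exact: lt_trans p1.
have q0 : 0 < q by exact: lt_le_trans q2.
exists (fun C rho => (D * (C * rho `^ (q / p' + 1))) `^ q^-1).
move=> mu a1 a2 a10 a12 mu0 C C0 carleson f [mf fN].
set B := _ `^ _.
have B0 : 0 <= B by exact: powR_ge0.
pose n := fine (LnormC leb pos p f).
have nE : LnormC leb pos p f = n%:E.
  by rewrite fineK// ge0_fin_numE ?LnormC_ge0.
have n0 : 0 <= n by rewrite fine_ge0// LnormC_ge0.
have intf : (\int[leb]_(t in pos) (normc (f t) `^ p)%:E <= (n `^ p)%:E)%E.
  by apply: LnormC_ge => //; rewrite nE.
have mfp : measurable_fun pos (fun t => normc (f t) `^ p) by exact: measurable_normc_powR.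
have fp : leb.-integrable pos (fun t => (normc (f t) `^ p)%:E).
  apply/integrableP; split; first exact/measurable_EFinP.
  under eq_integral do rewrite /= ger0_norm ?powR_ge0//.
  exact: le_lt_trans intf (ltry _).
have Rf N : n < N -> \int[leb]_(t in pos) (normc (f t) `^ p) <= N `^ p.
  move=> nN; apply: (@le_trans _ _ (n `^ p)).
    by apply: fine_le_EFin intf; apply: integral_ge0 => t _; rewrite lee_fin powR_ge0.
  by rewrite ge0_ler_powR ?nnegrE ?(ltW p0) ?(ltW nN)// (le_trans n0) ?ltW.
have mL := measurable_laplace mf.
have mLq : measurable_fun [set: borelC R] (fun z => normc (laplace f z) `^ q).
  exact: (measurableT_comp (@measurable_powR R q) (measurable_normc mL)).
have bound N : n < N -> (LnormC mu (Cplus R) q (laplace f) <= (B * N)%:E)%E.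
  move=> nN; have N0 : 0 < N by exact: le_lt_trans nN.
  apply: LnormC_le => //; first by rewrite mulr_ge0// ltW.
  rewrite (@integral_Cplus _ mu a1 a2)//; last by move=> z; exact: powR_ge0.
  apply: le_trans (hD mu a1 a2 C f N a10 a12 C0 carleson N0 mf fp (Rf _ nN)) _.
  rewrite lee_fin [leRHS]powRM ?(ltW N0)// /B -powRrM mulVf ?gt_eqF// powRr1//.
  by rewrite !mulr_ge0 ?powR_ge0// ltW.
have n1 : n < n + 1 by rewrite ltrDl.
split.
- move=> s s0; apply: (@integrable_laplace_integrand _ _ (complex.Re s)) => //.
  apply: (@integrable_damped1 _ _ p (n + 1)) => //; last exact: Rf.
  exact: le_lt_trans n1.
- split.
    by split; apply: measurable_funTS; case: mL.
  exact: le_lt_trans (bound _ n1) (ltry _).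
- rewrite nE; apply/lee_addgt0Pr => e e0.
  have B1 : 0 < B + 1 by rewrite ltr_wpDl.
  have eB : 0 < e / (B + 1) by rewrite divr_gt0.
  have := bound (n + e / (B + 1)); rewrite ltrDl => /(_ eB) h.
  apply: (le_trans h); rewrite -EFinM -EFinD lee_fin mulrDr lerD2l.
  by rewrite mulrCA ler_piMr ?(ltW e0)// ler_pdivrMr// mul1r lerDl.
Qed.

End upper_bound.

Section exponentials.
Variable R : realType.
Notation leb := (@lebesgue_measure R).
Notation pos := (posreals R).

Lemma normc_exp_fun (z : R[i]) (t : R) : normc (exp_fun z t) = expR (- (complex.Re z * t)).
Proof.
have := normc_laplace_integrand (fun=> 1) z t.
by rewrite /laplace_integrand mulr1 normc1 mulr1.
Qed.

Lemma exp_funE (z : R[i]) : exp_fun z = laplace_integrand (fun=> 1) z.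
Proof. by apply/funext => t; rewrite /laplace_integrand mulr1. Qed.

Lemma measurable_exp_fun (z : R[i]) : Defs.measurableC pos (exp_fun z).
Proof.
rewrite exp_funE; apply: measurable_laplace_integrand.
by split; exact: measurable_cst.
Qed.

Lemma LnormC_exp_fun (p : R) (z : R[i]) : 0 < p -> 0 < complex.Re z ->
  LnormC leb pos p (exp_fun z) = ((p * complex.Re z) `^ (- p^-1))%:E.
Proof.
move=> p0 z0.
have pz : 0 < p * complex.Re z by rewrite mulr_gt0.
have h : (LnormC leb pos p (exp_fun z) `^ p)%E = ((p * complex.Re z)^-1)%:E.
  rewrite poweR_LnormC ?gt_eqF// -integral_expR//.
  apply: eq_integral => t _; rewrite normc_exp_fun -expRM.
  by congr ((expR _)%:E); ring.
have := congr1 (fun x => (x `^ p^-1)%E) h.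
rewrite -poweRrM mulfV ?gt_eqF// poweRe1 ?LnormC_ge0// => ->.
by rewrite poweR_EFin -powR_inv1 ?(ltW pz)// -powRrM mulN1r.
Qed.

Lemma Re_exp_fun (z : R[i]) (t : R) : complex.Re (exp_fun z t) =
  expR (- (complex.Re z * t)) * cos (complex.Im z * t).
Proof. by rewrite exp_funE Re_laplace_integrand/= mulr1 mulr0 addr0. Qed.

Lemma Im_exp_fun (z : R[i]) (t : R) : complex.Im (exp_fun z t) =
  - (expR (- (complex.Re z * t)) * sin (complex.Im z * t)).
Proof. by rewrite exp_funE Im_laplace_integrand/= mulr1 mulr0 sub0r. Qed.

(** The real part of [1 / (s + z)]. *)
Lemma Re_laplace_exp_fun (z s : R[i]) : 0 < complex.Re z -> 0 < complex.Re s ->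
  complex.Re (laplace (exp_fun z) s) =
  (complex.Re s + complex.Re z) /
  ((complex.Re s + complex.Re z) ^+ 2 + (complex.Im s + complex.Im z) ^+ 2).
Proof.
move=> z0 s0; rewrite -Rintegral_expRcos ?addr_gt0//.
apply: eq_Rintegral => t _; rewrite Re_laplace_integrand Re_exp_fun Im_exp_fun.
rewrite [in RHS]mulrDl opprD expRD [in RHS]mulrDl cosD; ring.
Qed.

Lemma laplace_bounded_to_exp (mu : {measure set (borelC R) -> \bar R}) (p q a1 a2 M : R) :
  0 < p -> 0 < a1 -> laplace_bounded_by mu p q M ->
  exists2 C : R, 0 < C & laplace_exp_condition mu p q a1 a2 C.
Proof.
move=> p0 a10 hM; exists (`|M| + 1); first by rewrite ltr_wpDl.
move=> z /andP[az _]; have z0 : 0 < complex.Re z by exact: lt_le_trans az.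
have E := LnormC_exp_fun p0 z0.
have mem : memLC leb pos p (exp_fun z).
  by split; [exact: measurable_exp_fun|rewrite E ltry].
have [_ _ h] := hM _ mem; apply: le_trans h _.
rewrite E -!EFinM lee_fin ler_wpM2r ?powR_ge0//.
by rewrite (le_trans (ler_norm _))// lerDl.
Qed.

End exponentials.

Section lower.
Variable R : realType.
Variables (mu : {measure set (borelC R) -> \bar R}) (p q a1 a2 C r : R).
Hypothesis p0 : 0 < p.
Hypothesis q0 : 0 < q.
Hypothesis r1 : 1 <= r.
Hypothesis a1_gt0 : 0 < a1.
Hypothesis a12 : a1 <= a2.
Hypothesis C0 : 0 < C.
Hypothesis mu0 : supported_in mu (strip a1 a2).
Hypothesis hexp : laplace_exp_condition mu p q a1 a2 C.

Let a2_gt0 : 0 < a2. Proof. exact: lt_le_trans a12. Qed.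

Let k0 := 2 * a1 / ((a2 + a1) ^+ 2 + (2 * a2) ^+ 2).
Let den_gt0 : 0 < (a2 + a1) ^+ 2 + (2 * a2) ^+ 2.
Proof. by rewrite addr_gt0// exprn_gt0// ?mulr_gt0// addr_gt0. Qed.
Let k0_gt0 : 0 < k0. Proof. by rewrite divr_gt0// mulr_gt0. Qed.

(** For [z = a1 - ic] the numerator of [Re 1 / (s + z)] is at least [2 a1], and
    both terms of the denominator are bounded on the box. *)
Lemma laplace_exp_box_ge c s : box a1 a2 c s ->
  k0 <= normc (laplace (exp_fun (a1 -i* c)%C) s).
Proof.
move=> [/= /andP[as_ sa] /andP[cs sc]].
apply: (@le_trans _ _ (complex.Re (laplace (exp_fun (a1 -i* c)%C) s))); last first.
  exact: le_trans (ler_norm _) (Re_le_normc _).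
rewrite Re_laplace_exp_fun//=; last exact: lt_le_trans as_.
rewrite /k0 ler_pM ?invr_ge0 ?(ltW den_gt0)//.
- by rewrite mulr_ge0// ltW.
- by lra.
rewrite lef_pV2 ?posrE//; last first.
  by rewrite ltr_pwDl ?sqr_ge0// exprn_gt0// addr_gt0// (lt_le_trans a1_gt0).
rewrite lerD// ler_pXn2r ?nnegrE//; move: a1_gt0 a2_gt0; lra.
Qed.

Let M := ((C * (p * a1) `^ (- p^-1)) `^ q) / k0 `^ q.

Let M0 : 0 <= M. Proof. by rewrite divr_ge0 ?powR_ge0. Qed.

(** Chebyshev's inequality for the transform of [e^(-tz)], [z = a1 - ic]. *)
Lemma exp_box_measure c : (mu (box a1 a2 c) <= M%:E)%E.
Proof.
pose z := (a1 -i* c)%C.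
have sz : strip a1 a2 z by rewrite /strip/= lexx.
have := hexp sz; rewrite LnormC_exp_fun// -EFinM => h.
have := LnormC_ge q0 _ h; rewrite mulr_ge0 ?powR_ge0 ?(ltW C0)// => /(_ isT) {}h.
have mL := measurable_laplace (measurable_exp_fun z).
have mLq D : measurable_fun (D : set (borelC R)) (fun s => (normc (laplace (exp_fun z) s) `^ q)%:E).
  by apply: measurable_laplace_powR; exact: measurable_exp_fun.
have : ((k0 `^ q)%:E * mu (box a1 a2 c) <= ((C * (p * a1) `^ (- p^-1)) `^ q)%:E)%E.
  apply: le_trans h; rewrite -integral_cst; last exact: measurable_box.
  apply: (@le_trans _ _ (\int[mu]_(s in box a1 a2 c) (normc (laplace (exp_fun z) s) `^ q)%:E)%E).
    apply: ge0_le_integral => //.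
    - exact: measurable_box.
    - by move=> s _; rewrite lee_fin powR_ge0.
    - move=> s bs; rewrite lee_fin ge0_ler_powR ?nnegrE ?(ltW q0) ?(ltW k0_gt0) ?normc_ge0//.
      exact: laplace_exp_box_ge.
  apply: ge0_subset_integral => //.
  - exact: measurable_box.
  - exact: measurable_Cplus.
  - by move=> s _; rewrite lee_fin powR_ge0.
  - by move=> s [ss _]; exact: (strip_Cplus a1_gt0 ss).
have kq : 0 < k0 `^ q by rewrite powR_gt0.
by rewrite /M EFinM lee_pdivlMr// muleC.
Qed.

Lemma interval_length_ge (I : set R) x y : is_interval I -> bounded_set I ->
  I x -> I y -> y - x <= interval_length I.
Proof.
move=> itvI bI Ix Iy; have [yx|xy] := leP y x.
  by rewrite (@le_trans _ _ 0)// ?subr_le0// fine_ge0.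
have [A [_ hA]] := bI.
(* Boundedness is stated for all bounds beyond [A]. *)
pose b := `|A| + 1.
have Ib u : I u -> `|u| <= b.
  by move=> Iu; apply: hA => //; rewrite /b (le_lt_trans (ler_norm _))// ltrDl.
have b0 : 0 <= b by exact: le_trans (normr_ge0 _) (Ib _ Ix).
have mI : measurable I by exact: is_interval_measurable.
have le1 : (lebesgue_measure I <= (b - - b)%:E)%E.
  apply: (@le_trans _ _ (lebesgue_measure `[- b, b]%classic)).
    apply: le_measure; rewrite ?inE//.
    by move=> u Iu /=; rewrite in_itv/= -ler_norml Ib.
  rewrite lebesgue_measure_itv/= lte_fin; case: ifP => // _.
  by rewrite lee_fin opprK addr_ge0.
have le2 : ((y - x)%:E <= lebesgue_measure I)%E.
  have := lebesgue_measure_itv `[x, y]; rewrite /= lte_fin xy -EFinB => <-.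
  apply: le_measure; rewrite ?inE//.
  by move=> u /=; rewrite in_itv/=; exact: itvI.
rewrite /interval_length -lee_fin fineK// ge0_fin_numE//.
exact: le_lt_trans le1 (ltry _).
Qed.

(** Squares of side at most [a1] miss the strip; the others are covered by at
    most [2 |I| / a1] boxes, and [|I| / a1 <= (|I| / a1)^r]. *)
Lemma exp_to_carleson : exists2 C' : R, 0 < C' & carleson_condition mu r C'.
Proof.
pose C' := 2 * M * a1 `^ (- r) + 1.
have C'0 : 0 < C'.
  by rewrite ltr_wpDl// mulr_ge0 ?powR_ge0//; exact: mulr_ge0.
exists C' => // I itvI bI.
set l := interval_length I.
have l0 : 0 <= l by exact: fine_ge0.
have mQ := measurable_carleson_square itvI.
have mS := @measurable_strip R a1 a2.
have Q_le : (mu (carleson_square I) <= mu (carleson_square I `&` strip a1 a2))%E.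
  apply: (@le_trans _ _ (mu ((carleson_square I `&` strip a1 a2) `|` ~` strip a1 a2))).
    apply: le_measure; rewrite ?inE//.
      by apply: measurableU; [exact: measurableI|exact: measurableC].
    by move=> z Qz; have [sz|sz] := pselect (strip a1 a2 z); [left|right].
  apply: le_trans (measureU2 _ _ _) _; [exact: measurableI|exact: measurableC|].
  rewrite [X in (_ + X)%E](_ : _ = 0%E) ?adde0//; exact: mu0.
apply: (le_trans Q_le).
have [la|al] := leP l a1.
  rewrite (_ : _ `&` _ = set0) ?measure0 ?lee_fin ?mulr_ge0 ?powR_ge0 ?(ltW C'0)//.
  apply/seteqP; split => // z [[_ /andP[_ zl]] /andP[az _]].
  by have := lt_le_trans (le_lt_trans az zl) la; rewrite ltxx.
have [x0 Ix0] : exists x0, I x0.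
  apply/set0P; apply/eqP => I0.
  by move: al; rewrite /l /interval_length I0 measure0/= ltNge (ltW a1_gt0).
have Isub u : I u -> x0 - l <= u <= x0 + l.
  move=> Iu; have := interval_length_ge itvI bI Ix0 Iu.
  by have := interval_length_ge itvI bI Iu Ix0; rewrite -/l; lra.
pose c (i : nat) := x0 - l + i%:R * (2 * a2).
pose n := (Num.truncn (l / a2)).+1.
have la0 : 0 <= l / a2 by rewrite divr_ge0// ltW.
have cover : carleson_square I `&` strip a1 a2 `<=` \bigcup_(i in `I_n) box a1 a2 (c i).
  move=> z [[/Isub /andP[z1 z2] _] sz].
  (* The index of the box that contains [z]. *)
  pose u := (complex.Im z - (x0 - l)) / (2 * a2).
  have u0 : 0 <= u by rewrite divr_ge0// ?subr_ge0// mulr_ge0// ltW.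
  have /andP[ul ur] := truncn_itv u0.
  have un : (Num.truncn u < n)%N.
    rewrite /n ltnS le_truncn// /u invfM mulrA ler_wpM2r ?invr_ge0 ?(ltW a2_gt0)//.
    by rewrite ler_pdivrMr//; lra.
  exists (Num.truncn u) => //; split => //=.
  move: ul ur; rewrite /u ler_pdivlMr ?mulr_gt0// ltr_pdivrMr ?mulr_gt0//.
  by rewrite /c -natr1; lra.
have sum_le : (mu (carleson_square I `&` strip a1 a2) <= \sum_(i < n) mu (box a1 a2 (c i)))%E.
  have := @content_subadditive _ _ _ mu (carleson_square I `&` strip a1 a2)
    (fun i => box a1 a2 (c i)) n.
  apply => //.
  - by move=> i _; exact: measurable_box.
  - exact: measurableI.
  - by move: cover; rewrite bigcup_mkord.
apply: (le_trans sum_le).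
apply: (@le_trans _ _ (\sum_(i < n) M%:E)%E).
  by apply: lee_sum => i _; exact: exp_box_measure.
rewrite sumEFin lee_fin sumr_const card_ord -mulr_natl.
have nl : n%:R <= 2 * (l / a1).
  have h1 : 1 <= l / a1 by rewrite ler_pdivlMr// mul1r ltW.
  have h2 : l / a2 <= l / a1 by rewrite ler_wpM2l// lef_pV2.
  by have /andP[h3 _] := truncn_itv la0; rewrite /n -natr1; lra.
have lr : l / a1 <= l `^ r * a1 `^ (- r).
  have h1 : 1 <= l / a1 by rewrite ler_pdivlMr// mul1r ltW.
  have h2 : l / a1 = (l / a1) `^ 1 by rewrite powRr1// divr_ge0// ltW.
  rewrite {1}h2 (le_trans (ler_powR h1 r1))//.
  rewrite powRM ?invr_ge0 ?(ltW a1_gt0)// -powR_inv1 ?(ltW a1_gt0)// -powRrM mulN1r.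
  by [].
rewrite /C' mulrDl mul1r.
apply: (@le_trans _ _ (2 * M * a1 `^ (- r) * l `^ r)); last by rewrite lerDl powR_ge0.
have := ler_wpM2r M0 nl; have := ler_wpM2l M0 lr.
lra.
Qed.

End lower.

Theorem theorem3p6 (R : realType) (p p' q : R)
    (hp : 1 < p) (hpp' : p^-1 + p'^-1 = 1)
    (hp' : 1 < p') (hp'q : p' <= q) (hq : 2 <= q) :
  exists B : R -> R -> R,
  forall (mu : {measure set (borelC R) -> \bar R}) (a1 a2 : R),
    0 < a1 -> a1 <= a2 ->
    regular_measure mu -> supported_in mu (strip a1 a2) ->
    [<-> exists M : R, laplace_bounded_by mu p q M;
         exists2 C : R, 0 < C & carleson_condition mu (q / p') C;
         exists2 C : R, 0 < C & laplace_exp_condition mu p q a1 a2 C] /\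
    (forall C : R, 0 < C -> carleson_condition mu (q / p') C ->
       laplace_bounded_by mu p q (B C (a2 / a1))).
Proof.
have [B hB] := carleson_to_laplace hp hpp' hp' hp'q hq.
have p0 : 0 < p by exact: lt_trans hp.
have q0 : 0 < q by exact: lt_le_trans hq.
have r1 : 1 <= q / p' by rewrite ler_pdivlMr ?mul1r// (lt_trans _ hp').
exists B => mu a1 a2 a10 a12 _ mu0.
have c13 M : laplace_bounded_by mu p q M ->
    exists2 C : R, 0 < C & laplace_exp_condition mu p q a1 a2 C.
  exact: laplace_bounded_to_exp.
have c32 : (exists2 C : R, 0 < C & laplace_exp_condition mu p q a1 a2 C) ->
    exists2 C : R, 0 < C & carleson_condition mu (q / p') C.
  by move=> [C C0 hC]; exact: exp_to_carleson hC.
have c21 : (exists2 C : R, 0 < C & carleson_condition mu (q / p') C) ->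
    exists M : R, laplace_bounded_by mu p q M.
  by move=> [C C0 hC]; exists (B C (a2 / a1)); exact: hB.
split; last by move=> C C0 hC; exact: hB.
tfae.
- by move=> [M /c13/c32].
- by move=> /c21[M /c13].
- by move=> /c32/c21.
Qed.
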